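(* Let $a\in[0,1)$ and $q_a:=\min\big(\log_2(2-a),\tfrac12\big)$. If the complex potential $V=\mathrm{diag}(v_1,v_2,\dots)$ satisfies, for some constant $c<1$ and some $q\in(0,q_a]$, \[ |v_n|\le c\Big[2-\Big(1-\frac1n\Big)^q-\Big(1+\frac1n\Big)^q-a\,\delta_{n,1}\Big]\qquad\text{for all } n\in\mathbb{N}, \] then $\sigma(J_a+V)=\sigma_{\mathrm c}(J_a+V)=[-2,2]$. If this condition is fulfilled with $c=1$, then $\sigma_{\mathrm d}(J_a+V)=\emptyset$.
   Context: $\mathbb{N}=\{1,2,\dots\}$. For $a\in\mathbb{C}$, $J_a$ is the operator on $\ell^2(\mathbb{N})$ with $(J_a\psi)_1=a\psi_1+\psi_2$ and $(J_a\psi)_n=\psi_{n-1}+\psi_{n+1}$ for $n\ge2$. $\sigma_{\mathrm c}$ denotes the continuous spectrum and $\sigma_{\mathrm d}$ the discrete spectrum (isolated eigenvalues of finite algebraic multiplicity). *)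

(* Defs.v *)
From Stdlib Require Import Reals Lra.
From Coquelicot Require Import Coquelicot.
Open Scope R_scope.

(* Sequences on N = {1,2,...} are represented as functions nat -> C,
   index k : nat standing for the paper's index n = k+1. *)
Definition seqC := nat -> C.

Definition l2 (psi : seqC) : Prop := ex_series (fun n => (Cmod (psi n)) ^ 2).

Definition norm2 (psi : seqC) : R := Series (fun n => (Cmod (psi n)) ^ 2).

(* The operator J_a + V, with V = diag(v_1, v_2, ...) and v k = v_{k+1},
   acting (formally) on all sequences. *)
Definition JV (a : R) (v : seqC) (psi : seqC) : seqC :=
  fun n => match n with
           | O => Cplus (Cplus (Cmult (RtoC a) (psi O)) (Cmult (v O) (psi O))) (psi 1%nat)
           | S m => Cplus (Cplus (psi m) (Cmult (v n) (psi n))) (psi (S n))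
           end.

Definition shiftop (T : seqC -> seqC) (z : C) (psi : seqC) : seqC :=
  fun n => Cminus (T psi n) (Cmult z (psi n)).

Definition op_injective (T : seqC -> seqC) : Prop :=
  forall psi, l2 psi -> (forall n, T psi n = 0%C) -> forall n, psi n = 0%C.

Definition op_surjective (T : seqC -> seqC) : Prop :=
  forall phi, l2 phi -> exists psi, l2 psi /\ forall n, T psi n = phi n.

Definition op_dense_range (T : seqC -> seqC) : Prop :=
  forall phi, l2 phi -> forall eps, 0 < eps ->
    exists psi, l2 psi /\ norm2 (fun n => Cminus (T psi n) (phi n)) < eps.

(* spectrum: T - z is not a bijection of l^2 (for a bounded operator the
   inverse is then automatically bounded) *)
Definition in_spectrum (T : seqC -> seqC) (z : C) : Prop :=
  ~ (op_injective (shiftop T z) /\ op_surjective (shiftop T z)).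

Definition in_cont_spectrum (T : seqC -> seqC) (z : C) : Prop :=
  op_injective (shiftop T z) /\ op_dense_range (shiftop T z)
  /\ ~ op_surjective (shiftop T z).

Definition is_eigenvalue (T : seqC -> seqC) (z : C) : Prop :=
  exists psi, l2 psi /\ (exists n, psi n <> 0%C) /\
              forall n, shiftop T z psi n = 0%C.

Definition isolated_in_spectrum (T : seqC -> seqC) (z : C) : Prop :=
  in_spectrum T z /\
  exists r, 0 < r /\ forall w, w <> z -> Cmod (Cminus w z) < r -> ~ in_spectrum T w.

(* finite algebraic multiplicity: the root space
   { psi in l^2 | (T - z)^k psi = 0 for some k } is finite dimensional *)
Definition finite_alg_mult (T : seqC -> seqC) (z : C) : Prop :=
  exists (N : nat) (b : nat -> seqC),
    forall psi, l2 psi ->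
      (exists k : nat, forall n, Nat.iter k (shiftop T z) psi n = 0%C) ->
      exists alpha : nat -> C, forall n,
        psi n = sum_n (fun i => Cmult (alpha i) (b i n)) N.

Definition in_disc_spectrum (T : seqC -> seqC) (z : C) : Prop :=
  isolated_in_spectrum T z /\ is_eigenvalue T z /\ finite_alg_mult T z.

(* real power x^q with the convention 0^q = 0 for q > 0 (Stdlib's Rpower
   would give Rpower 0 q = 1) *)
Definition rpow (x q : R) : R := if Req_EM_T x 0 then 0 else Rpower x q.

Definition log2 (x : R) : R := ln x / ln 2.

Definition q_a (a : R) : R := Rmin (log2 (2 - a)) (1/2).

Definition hardy_weight (a q : R) (k : nat) : R :=
  let n := INR (S k) in
  2 - rpow (1 - 1/n) q - rpow (1 + 1/n) q - (if Nat.eqb k 0 then a else 0).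

Definition on_interval_m2_2 (z : C) : Prop := Im z = 0 /\ -2 <= Re z <= 2.

(* Main.v *)
Require Import Defs.
From Stdlib Require Import Reals Lra Lia ClassicalEpsilon.
From Coquelicot Require Import Coquelicot.
Open Scope R_scope.

(** Write [z = k + 1/k] with [0 < |k| <= 1]; then [|k| = 1] exactly when [z] lies in [[-2,2]].  The
    Green kernel of [J_a] is [- k^|m-n| P (min m n)] with [P (n+1) = k + k^2 P n], hence it is
    dominated in modulus by its value at [k = 1], which inverts [2 - J_a].  Since
    [g n = n^q] satisfies [(2 - J_a) g = w g] for the Hardy weight [w], the operator [psi |-> G_z V psi]
    is bounded by [c] in the norm [sup |psi n| / g n], uniformly in [z], the interval included.

    - A square-summable eigenvector would attain its weighted supremum; as [w > 0] away from the first
      site this is impossible even for [c = 1].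
    - For [c < 1] the equation [(J_a + V - z) psi = phi] with suitable [phi] has a solution of size
      [O(g)]: solve it on [{0..N}] with the outgoing condition [psi (N+1) = k psi N] and extract a
      limit.  For [|k| < 1] this solution is square summable, whence surjectivity off [[-2,2]].
    - For [|k| = 1] and [phi] of finite support, a logarithmic cutoff of the solution, which is
      [O(sqrt n)] because [q <= 1/2], gives density of the range.
    - For [|k| = 1], if [phi] is in the range then [sum k^n phi n] has bounded partial sums; this
      fails for [phi n = k^(-n) / (n + 1)]. *)

(** * Finite sums, series and square-summable sequences *)

Lemma sum_Sn_R (f : nat -> R) N : sum_n f (S N) = sum_n f N + f (S N).
Proof. exact (sum_Sn f N). Qed.

Lemma sum_Sn_C (f : nat -> C) N : sum_n f (S N) = (sum_n f N + f (S N))%C.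
Proof. exact (sum_Sn f N). Qed.

Lemma sum_n_le (f g : nat -> R) N :
  (forall n, (n <= N)%nat -> f n <= g n) -> sum_n f N <= sum_n g N.
Proof.
  induction N as [|N IH]; intros H.
  - rewrite !sum_O; apply H; lia.
  - rewrite !sum_Sn_R; apply Rplus_le_compat; [apply IH; intros; apply H; lia | apply H; lia].
Qed.

Lemma sum_n_nonneg (f : nat -> R) N : (forall n, 0 <= f n) -> 0 <= sum_n f N.
Proof.
  intros H; induction N as [|N IH].
  - rewrite sum_O; apply H.
  - rewrite sum_Sn_R; generalize (H (S N)); lra.
Qed.

Lemma sum_n_zero (f : nat -> R) N : (forall n, f n = 0) -> sum_n f N = 0 :> R.
Proof.
  intros H; induction N as [|N IH]; [now rewrite sum_O|].
  rewrite sum_Sn_R, IH, H; ring.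
Qed.

Lemma sum_n_incr (f : nat -> R) M N :
  (forall n, 0 <= f n) -> (M <= N)%nat -> sum_n f M <= sum_n f N.
Proof.
  intros H; induction 1 as [|N _ IH]; [lra|].
  rewrite sum_Sn_R; generalize (H (S N)); lra.
Qed.

Lemma term_le_sum_n (f : nat -> R) m N :
  (forall n, 0 <= f n) -> (m <= N)%nat -> f m <= sum_n f N.
Proof.
  intros H Hm; apply Rle_trans with (sum_n f m); [|now apply sum_n_incr].
  destruct m as [|m]; [rewrite sum_O; lra|].
  rewrite sum_Sn_R; generalize (sum_n_nonneg f m H); lra.
Qed.

Lemma sum_n_Rmult_l (c : R) (f : nat -> R) N :
  sum_n (fun n => c * f n) N = c * sum_n f N.
Proof. exact (sum_n_mult_l c f N). Qed.

Lemma sum_n_Rplus (f g : nat -> R) N :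
  sum_n (fun n => f n + g n) N = sum_n f N + sum_n g N.
Proof. exact (sum_n_plus f g N). Qed.

Lemma Cmod_sum_n (f : nat -> C) N : Cmod (sum_n f N) <= sum_n (fun n => Cmod (f n)) N.
Proof.
  induction N as [|N IH].
  - rewrite !sum_O; apply Rle_refl.
  - rewrite sum_Sn_R, sum_Sn_C; eapply Rle_trans; [apply Cmod_triangle | lra].
Qed.

Lemma Cmod_minus_le (x y : C) : Cmod (x - y) <= Cmod x + Cmod y.
Proof. unfold Cminus; rewrite <- (Cmod_opp y); apply Cmod_triangle. Qed.

Lemma series_bounded (f : nat -> R) B :
  (forall n, 0 <= f n) -> (forall N, sum_n f N <= B) -> ex_series f /\ Series f <= B.
Proof.
  intros H HB.
  destruct (ex_finite_lim_seq_incr (sum_n f) B) as [l Hl]; auto.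
  - intros n; apply sum_n_incr; auto.
  - assert (Hs : is_series f l) by exact Hl.
    split; [now exists l|].
    rewrite (is_series_unique _ _ Hs).
    apply (is_lim_seq_le (sum_n f) (fun _ => B) l B HB Hl (is_lim_seq_const B)).
Qed.

Lemma sum_n_le_Series (f : nat -> R) N :
  (forall n, 0 <= f n) -> ex_series f -> sum_n f N <= Series f.
Proof.
  intros H Hs.
  apply (is_lim_seq_le_loc (fun _ => sum_n f N) (sum_n f) (sum_n f N) (Series f)).
  - exists N; intros n Hn; now apply sum_n_incr.
  - apply is_lim_seq_const.
  - exact (Series_correct f Hs).
Qed.

Lemma l2_lim_0 (psi : seqC) : l2 psi -> is_lim_seq (fun n => Cmod (psi n)) 0.
Proof.
  intros H; apply ex_series_lim_0 in H.
  apply is_lim_seq_ext with (fun n => sqrt (Cmod (psi n) ^ 2)).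
  - intros n; apply sqrt_pow2, Cmod_ge_0.
  - rewrite <- sqrt_0; apply (is_lim_seq_continuous sqrt); [|exact H].
    apply continuity_pt_sqrt; lra.
Qed.

Lemma l2_bounded (psi : seqC) : l2 psi -> exists M, 0 <= M /\ forall n, Cmod (psi n) <= M.
Proof.
  intros H; exists (sqrt (norm2 psi)); split; [apply sqrt_pos|].
  intros n; rewrite <- (sqrt_pow2 (Cmod (psi n))) by apply Cmod_ge_0.
  apply sqrt_le_1_alt.
  eapply Rle_trans; [|apply (sum_n_le_Series _ n); auto using pow2_ge_0].
  apply (term_le_sum_n (fun n => Cmod (psi n) ^ 2)); auto using pow2_ge_0.
Qed.

Lemma exists_max_upto (x : nat -> R) N :
  exists m, (m <= N)%nat /\ forall n, (n <= N)%nat -> x n <= x m.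
Proof.
  induction N as [|N (m & Hm & IH)].
  - exists O; split; auto; intros n Hn; replace n with O by lia; lra.
  - destruct (Rle_dec (x m) (x (S N))) as [H|H].
    + exists (S N); split; auto; intros n Hn.
      destruct (Nat.eq_dec n (S N)) as [->|]; [lra|].
      apply Rle_trans with (x m); auto; apply IH; lia.
    + exists m; split; [lia|]; intros n Hn.
      destruct (Nat.eq_dec n (S N)) as [->|]; [lra|]; apply IH; lia.
Qed.

(** All but finitely many terms lie below [x n0], so the maximum over an initial segment containing
    [n0] is global. *)
Lemma exists_max_of_lim_0 (x : nat -> R) n0 :
  is_lim_seq x 0 -> 0 < x n0 -> exists m, forall n, x n <= x m.
Proof.
  intros Hx H0.
  apply is_lim_seq_spec in Hx; destruct (Hx (mkposreal _ H0)) as [N HN]; simpl in HN.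
  destruct (exists_max_upto x (n0 + N)) as (m & _ & Hm).
  exists m; intros n; destruct (Nat.le_gt_cases n (n0 + N)) as [H|H]; auto.
  apply Rle_trans with (x n0); [|apply Hm; lia].
  specialize (HN n ltac:(lia)); apply Rabs_def2 in HN; lra.
Qed.

(** * Harmonic numbers and the logarithm *)

Fixpoint harm (n : nat) : R :=
  match n with O => 0 | S m => harm m + / INR (S m) end.

Lemma ln_le_minus_1 x : 0 < x -> ln x <= x - 1.
Proof.
  intros Hx; generalize (exp_ineq1_le (ln x)); rewrite exp_ln; lra.
Qed.

Lemma ln_lt_minus_1 x : 0 < x -> x <> 1 -> ln x < x - 1.
Proof.
  intros Hx Hx1; assert (ln x <> 0).
  { intros H; apply Hx1, ln_inv; try lra; now rewrite ln_1. }
  generalize (exp_ineq1 (ln x) H); rewrite exp_ln; lra.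
Qed.

Lemma INR_S_pos n : 0 < INR (S n).
Proof. apply lt_0_INR; lia. Qed.

Lemma harm_ge_ln n : ln (INR (S n)) <= harm n.
Proof.
  induction n as [|n IH]; [simpl; rewrite ln_1; lra|].
  change (harm (S n)) with (harm n + / INR (S n)).
  generalize (INR_S_pos n) (INR_S_pos (S n)); intros H1 H2.
  replace (INR (S (S n))) with (INR (S n) * (1 + / INR (S n)))
    by (rewrite (S_INR (S n)); field; lra).
  assert (0 < / INR (S n)) by now apply Rinv_0_lt_compat.
  rewrite ln_mult by lra.
  generalize (ln_le_minus_1 (1 + / INR (S n)) ltac:(lra)); lra.
Qed.

Lemma harm_incr m n : (m <= n)%nat -> harm m <= harm n.
Proof.
  induction 1 as [|n _ IH]; [lra|]; change (harm (S n)) with (harm n + / INR (S n)).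
  generalize (Rinv_0_lt_compat _ (INR_S_pos n)); lra.
Qed.

Lemma harm_nonneg n : 0 <= harm n.
Proof. apply (harm_incr 0 n); lia. Qed.

Lemma harm_unbounded B : exists n, B < harm n.
Proof.
  destruct (INR_unbounded (exp B)) as [n Hn].
  exists n; eapply Rlt_le_trans; [|apply harm_ge_ln].
  rewrite <- (ln_exp B); apply ln_increasing; [apply exp_pos|rewrite S_INR; lra].
Qed.

(** Telescoping comparison of [1/(x+1)^2] with [1/x - 1/(x+1)]. *)
Lemma sum_n_inv_sq_le N : sum_n (fun n => (/ INR (S n)) ^ 2) N <= 2 - / INR (S N).
Proof.
  induction N as [|N IH]; [rewrite sum_O; simpl; lra|].
  rewrite sum_Sn_R; eapply Rle_trans; [apply Rplus_le_compat_r, IH|].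
  generalize (INR_S_pos N); intros H; rewrite (S_INR (S N)); set (x := INR (S N)) in *.
  cut (0 <= / x - / (x + 1) - (/ (x + 1)) ^ 2); [lra|].
  replace (/ x - / (x + 1) - (/ (x + 1)) ^ 2) with (/ (x * (x + 1) ^ 2))
    by (field; lra).
  apply Rlt_le, Rinv_0_lt_compat; nra.
Qed.

(** * Convergent subsequences *)

(** Around a cluster point, an index [p >= n] with error below [1/(n+1)] is chosen for each [n]. The
    indices need not increase: [n <= sigma n] is enough to carry statements about tails. *)
Lemma bounded_subsequence (u : nat -> R) M :
  (forall n, Rabs (u n) <= M) ->
  exists (sigma : nat -> nat) (l : R),
    (forall n, (n <= sigma n)%nat) /\ is_lim_seq (fun n => u (sigma n)) l.
Proof.
  intros HM.
  destruct (Bolzano_Weierstrass u (fun x => - M <= x <= M)) as [l Hl].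
  { apply compact_P3. }
  { intros n; specialize (HM n); apply Rabs_le_between in HM; lra. }
  assert (H : forall n, exists p, (n <= p)%nat /\ Rabs (u p - l) < / INR (S n)).
  { intros n; destruct (Hl (disc l (mkposreal _ (Rinv_0_lt_compat _ (INR_S_pos n)))) n)
      as (p & Hp & Hd).
    - exists (mkposreal _ (Rinv_0_lt_compat _ (INR_S_pos n))); intros x Hx; exact Hx.
    - now exists p. }
  exists (fun n => proj1_sig (constructive_indefinite_description _ (H n))), l.
  split; intros.
  - destruct (constructive_indefinite_description _ (H n)) as (p & Hp & Hd); exact Hp.
  - apply is_lim_seq_spec; intros eps.
    destruct (INR_unbounded (/ eps)) as [N HN]; exists N; intros n Hn.
    destruct (constructive_indefinite_description _ (H n)) as (p & Hp & Hd); simpl.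
    eapply Rlt_trans; [exact Hd|].
    rewrite <- (Rinv_inv eps); apply Rinv_lt_contravar.
    + apply Rmult_lt_0_compat; [apply Rinv_0_lt_compat, cond_pos | apply INR_S_pos].
    + eapply Rlt_le_trans; [exact HN|]; apply le_INR; lia.
Qed.

Lemma bounded_subsequence_C (t : nat -> C) M :
  (forall n, Cmod (t n) <= M) ->
  exists (sigma : nat -> nat) (l : C),
    (forall n, (n <= sigma n)%nat) /\ is_lim_seq (fun n => Cmod (t (sigma n) - l)) 0.
Proof.
  intros HM.
  destruct (bounded_subsequence (fun n => fst (t n)) M) as (s1 & x & H1 & Hx).
  { intros n; eapply Rle_trans; [|apply HM].
    eapply Rle_trans; [apply Rmax_l|apply Rmax_Cmod]. }
  destruct (bounded_subsequence (fun n => snd (t (s1 n))) M) as (s2 & y & H2 & Hy).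
  { intros n; eapply Rle_trans; [|apply (HM (s1 n))].
    eapply Rle_trans; [apply Rmax_r|apply Rmax_Cmod]. }
  exists (fun n => s1 (s2 n)), (x, y); split.
  { intros n; eapply Nat.le_trans; [apply H2|apply H1]. }
  assert (Hx' : is_lim_seq (fun n => fst (t (s1 (s2 n)))) x).
  { apply (filterlim_comp _ _ _ s2 (fun n => fst (t (s1 n))) eventually eventually); [|exact Hx].
    intros P [N HN]; exists N; intros n Hn; apply HN; specialize (H2 n); lia. }
  assert (Hd : is_lim_seq (fun n => Rabs (fst (t (s1 (s2 n))) - x) + Rabs (snd (t (s1 (s2 n))) - y)) 0).
  { replace 0 with (0 + 0) by ring; apply is_lim_seq_plus'.
    - apply -> is_lim_seq_abs_0; replace 0 with (x - x) by ring.
      apply is_lim_seq_minus'; [exact Hx'|apply is_lim_seq_const].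
    - apply -> is_lim_seq_abs_0; replace 0 with (y - y) by ring.
      apply is_lim_seq_minus'; [exact Hy|apply is_lim_seq_const]. }
  refine (is_lim_seq_le_le (fun _ => 0) _ _ 0 _ (is_lim_seq_const 0) Hd).
  intros n; split; [apply Cmod_ge_0|].
  unfold Cmod; simpl fst; simpl snd.
  apply Rsqr_incr_0_var; [|generalize (Rabs_pos (fst (t (s1 (s2 n))) - x)) (Rabs_pos (snd (t (s1 (s2 n))) - y)); lra].
  rewrite Rsqr_sqrt by (apply Rplus_le_le_0_compat; apply pow2_ge_0).
  rewrite <- (pow2_abs (_ + - x)), <- (pow2_abs (_ + - y)); unfold Rsqr, Rminus.
  generalize (Rabs_pos (fst (t (s1 (s2 n))) + - x)) (Rabs_pos (snd (t (s1 (s2 n))) + - y)).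
  intros; nra.
Qed.

(** * The Hardy weight and its positive solution *)

(** With [A = 1 + q (t - 1)], the inequality [ln x <= x - 1] is taken at [t/A] (strictly) and at
    [1/A]. Weighted by [q] and [1 - q], the right-hand sides sum to zero, leaving
    [q ln t < ln A]. *)
Lemma Bernoulli_lt t q : 0 < t -> t <> 1 -> 0 < q < 1 -> Rpower t q < 1 + q * (t - 1).
Proof.
  intros Ht Ht1 Hq; set (A := 1 + q * (t - 1)).
  assert (HA : 0 < A) by (unfold A; nra).
  assert (HtA : t / A <> 1).
  { intros H; apply Ht1; apply (f_equal (fun x => x * A)) in H.
    unfold Rdiv in H; rewrite Rmult_assoc, Rinv_l in H by lra; unfold A in H; nra. }
  assert (H1 : ln (t / A) < t / A - 1)
    by (apply ln_lt_minus_1; auto; now apply Rdiv_lt_0_compat).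
  assert (H2 : ln (/ A) <= / A - 1) by (apply ln_le_minus_1, Rinv_0_lt_compat; lra).
  unfold Rdiv in H1; rewrite ln_mult in H1; auto using Rinv_0_lt_compat.
  rewrite ln_Rinv in H1, H2 by lra.
  assert (H3 : q * (t * / A) + (1 - q) * / A = 1) by (unfold A; field; fold A; lra).
  assert (H4 : q * ln t < ln A) by nra.
  unfold Rpower; rewrite <- (exp_ln A HA); now apply exp_increasing.
Qed.

Lemma rpow_pos x q : 0 < x -> rpow x q = Rpower x q.
Proof. intros H; unfold rpow; destruct (Req_EM_T x 0); lra. Qed.

(** The interface to [g = n^q]: the last two fields say [(2 - J_a) g = w g], and [hp_sqr_le] is the
    growth that the logarithmic cutoff tolerates. Positivity is strict only past the first site,
    because [w 0 = 2 - a - 2^q] may vanish. *)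
Record hardy_pair (a : R) (w g : nat -> R) : Prop := {
  hp_ge_1 : forall n, 1 <= g n;
  hp_incr : forall n, g n <= g (S n);
  hp_sqr_le : forall n, g n ^ 2 <= INR (S n);
  hp_nonneg : forall n, 0 <= w n;
  hp_pos : forall n, 0 < w (S n);
  hp_O : w O * g O = (2 - a) * g O - g 1%nat;
  hp_S : forall n, w (S n) * g (S n) = 2 * g (S n) - g n - g (S (S n)) }.

Lemma hardy_weight_pair a q : 0 <= a < 1 -> 0 < q <= q_a a ->
  hardy_pair a (hardy_weight a q) (fun n => Rpower (INR (S n)) q).
Proof.
  intros Ha [Hq Hqa].
  assert (Hq2 : q <= 1 / 2) by (eapply Rle_trans; [exact Hqa|apply Rmin_r]).
  assert (H2q : Rpower 2 q <= 2 - a).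
  { assert (H : q <= ln (2 - a) / ln 2) by (eapply Rle_trans; [exact Hqa|apply Rmin_l]).
    assert (Hl : 0 < ln 2) by (rewrite <- ln_1; apply ln_increasing; lra).
    assert (q * ln 2 <= ln (2 - a)).
    { apply (Rmult_le_compat_r (ln 2)) in H; [|lra].
      unfold Rdiv in H; rewrite Rmult_assoc, Rinv_l in H; lra. }
    rewrite <- (exp_ln (2 - a)) by lra; unfold Rpower.
    destruct H0 as [H0| ->]; [left; now apply exp_increasing|right; reflexivity]. }
  assert (Hpos : forall n, 0 < hardy_weight a q (S n)).
  { intros n; unfold hardy_weight; cbv zeta; simpl Nat.eqb.
    assert (Hn : 1 < INR (S (S n))) by (rewrite S_INR; generalize (INR_S_pos n); lra).
    assert (Hi : 0 < 1 / INR (S (S n)) < 1).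
    { split; [apply Rdiv_lt_0_compat; lra|].
      unfold Rdiv; rewrite Rmult_1_l, <- Rinv_1; apply Rinv_lt_contravar; lra. }
    rewrite !rpow_pos by lra.
    (* The linear terms of the two Bernoulli bounds cancel, so strict concavity makes the sum of the
       two powers less than 2. *)
    generalize (Bernoulli_lt (1 - 1 / INR (S (S n))) q ltac:(lra) ltac:(lra) ltac:(lra)).
    generalize (Bernoulli_lt (1 + 1 / INR (S (S n))) q ltac:(lra) ltac:(lra) ltac:(lra)).
    lra. }
  (* The convention [0^q = 0] enters here; the value is nonnegative because [q <= log2 (2 - a)]. *)
  assert (H0 : hardy_weight a q 0 = 2 - a - Rpower 2 q).
  { unfold hardy_weight; cbv zeta; simpl Nat.eqb; simpl INR.
    replace (1 - 1 / 1) with 0 by lra; replace (1 + 1 / 1) with 2 by lra.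
    rewrite (rpow_pos 2) by lra; unfold rpow; destruct (Req_EM_T 0 0); lra. }
  assert (H1 : forall n, 1 <= INR (S n)) by (intros n; rewrite S_INR; generalize (pos_INR n); lra).
  split.
  - intros n; rewrite <- (Rpower_O (INR (S n))) by apply INR_S_pos.
    destruct (H1 n) as [H|H]; [apply Rle_Rpower; lra|].
    rewrite <- H; unfold Rpower; rewrite ln_1, !Rmult_0_r; lra.
  - intros n; apply Rle_Rpower_l; [lra|]; split; [apply INR_S_pos|apply le_INR; lia].
  - intros n; rewrite <- Rsqr_pow2; unfold Rsqr; rewrite <- Rpower_plus.
    rewrite <- (Rpower_1 (INR (S n))) at 2 by apply INR_S_pos.
    destruct (H1 n) as [H|H]; [apply Rle_Rpower; lra|].
    rewrite <- H; unfold Rpower; rewrite ln_1, !Rmult_0_r; lra.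
  - intros [|n]; [rewrite H0; lra|now left].
  - exact Hpos.
  - rewrite H0; simpl INR; replace (1 + 1) with 2 by ring.
    replace (Rpower 1 q) with 1; [ring|].
    unfold Rpower; now rewrite ln_1, Rmult_0_r, exp_0.
  - intros n; unfold hardy_weight; cbv zeta; simpl Nat.eqb.
    generalize (INR_S_pos n) (INR_S_pos (S n)) (INR_S_pos (S (S n))); intros P0 P1 P2.
    replace (1 - 1 / INR (S (S n))) with (INR (S n) * / INR (S (S n)))
      by (rewrite (S_INR (S n)) in *; field; lra).
    replace (1 + 1 / INR (S (S n))) with (INR (S (S (S n))) * / INR (S (S n)))
      by (rewrite (S_INR (S (S n))) in *; field; lra).
    rewrite !rpow_pos by (apply Rmult_lt_0_compat; auto using Rinv_0_lt_compat).
    rewrite !Rmult_minus_distr_r.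
    rewrite <- !Rpower_mult_distr; auto using Rinv_0_lt_compat, Rmult_lt_0_compat.
    replace (Rpower (/ INR (S (S n))) q) with (/ Rpower (INR (S (S n))) q).
    + field; apply Rgt_not_eq, exp_pos.
    + rewrite <- Rpower_Ropp; unfold Rpower; rewrite ln_Rinv by auto; f_equal; ring.
Qed.

(** * The majorant of the Green kernel *)

(** The Green kernel at [k = 1], that is, the kernel of the formal inverse of [2 - J_a]. *)
Definition green_bound (a : R) (m n : nat) : R := / (1 - a) + INR (Nat.min m n).

Lemma green_bound_pos a m n : a < 1 -> 0 < green_bound a m n.
Proof.
  intros Ha; unfold green_bound; generalize (pos_INR (Nat.min m n)).
  assert (0 < / (1 - a)) by (apply Rinv_0_lt_compat; lra); lra.
Qed.

(** Up to the diagonal the kernel is [1/(1-a) + n], which [2 - J_a] annihilates. Inserting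
    [w g = (2 - J_a) g] therefore telescopes to boundary terms. *)
Lemma green_bound_sum_diag a w g m : a < 1 -> hardy_pair a w g ->
  sum_n (fun n => green_bound a m n * (w n * g n)) m
  = (/ (1 - a) + INR (S m)) * g m - (/ (1 - a) + INR m) * g (S m) :> R.
Proof.
  intros Ha Hp.
  assert (H : forall N, (N <= m)%nat -> sum_n (fun n => green_bound a m n * (w n * g n)) N
    = (/ (1 - a) + INR (S N)) * g N - (/ (1 - a) + INR N) * g (S N) :> R).
  { induction N as [|N IH]; intros HN.
    - rewrite sum_O, (hp_O _ _ _ Hp); unfold green_bound; rewrite Nat.min_0_r.
      simpl INR; field; lra.
    - rewrite sum_Sn_R, IH, (hp_S _ _ _ Hp) by lia; unfold green_bound.
      rewrite Nat.min_r by lia; rewrite !S_INR; ring. }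
  now apply H.
Qed.

(** Beyond the diagonal the kernel is constant in [n], so the sum telescopes to [g m] minus a
    multiple of an increment of [g], which is nonnegative. Since the terms are nonnegative, a short
    sum may first be extended past the diagonal. This is the contraction estimate in the norm
    [sup |psi n| / g n]. *)
Lemma green_bound_sum a w g m N : a < 1 -> hardy_pair a w g ->
  sum_n (fun n => green_bound a m n * (w n * g n)) N <= g m.
Proof.
  intros Ha Hp.
  assert (Hnn : forall n, 0 <= green_bound a m n * (w n * g n)).
  { intros n; apply Rmult_le_pos; [now apply Rlt_le, green_bound_pos|].
    apply Rmult_le_pos; [apply Hp|]; generalize (hp_ge_1 _ _ _ Hp n); lra. }
  assert (H : forall j, sum_n (fun n => green_bound a m n * (w n * g n)) (m + j)
    = g m - (/ (1 - a) + INR m) * (g (S (m + j)) - g (m + j)%nat) :> R).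
  { induction j as [|j IH].
    - rewrite Nat.add_0_r, green_bound_sum_diag by auto; rewrite S_INR; ring.
    - rewrite Nat.add_succ_r, sum_Sn_R, IH, (hp_S _ _ _ Hp); unfold green_bound.
      rewrite Nat.min_l by lia; ring. }
  eapply Rle_trans; [apply (sum_n_incr _ N (m + N)); auto; lia|].
  rewrite H; generalize (hp_incr _ _ _ Hp (m + N)) (green_bound_pos a m m Ha).
  unfold green_bound; rewrite Nat.min_id; intros; nra.
Qed.

(** Row 0 of the kernel is the constant [1/(1-a) >= 1], and [g 0 <= 1]. It makes [V psi] absolutely
    summable whenever [psi = O(g)] and [|v| <= w]. *)
Lemma sum_weight_le_1 a w g N : 0 <= a < 1 -> hardy_pair a w g ->
  sum_n (fun n => w n * g n) N <= 1.
Proof.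
  intros Ha Hp.
  generalize (green_bound_sum a w g 0 N (proj2 Ha) Hp).
  rewrite (sum_n_ext _ (fun n => / (1 - a) * (w n * g n))).
  2: { intros n; unfold green_bound; simpl; ring. }
  rewrite sum_n_Rmult_l; intros H.
  assert (H0 : g O <= 1).
  { generalize (hp_ge_1 _ _ _ Hp 0) (hp_sqr_le _ _ _ Hp 0); simpl; intros; nra. }
  assert (Hs : 0 <= sum_n (fun n => w n * g n) N).
  { apply sum_n_nonneg; intros n.
    apply Rmult_le_pos; [apply Hp|]; generalize (hp_ge_1 _ _ _ Hp n); lra. }
  assert (1 <= / (1 - a)) by (rewrite <- Rinv_1; apply Rinv_le_contravar; lra).
  nra.
Qed.

(** * The Green kernel at spectral parameter [k + 1/k] *)

(** The starting value solves the equation of the first site, [(a - 1/k) P 0 = -1]. *)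
Fixpoint green_diag (a : R) (k : C) (n : nat) : C :=
  match n with
  | O => (k / (1 - a * k))%C
  | S m => (k + k * k * green_diag a k m)%C
  end.

(** The sign is that of [(z - J_a)^(-1)]. The sum of the two truncated differences is [|m - n|]. *)
Definition green (a : R) (k : C) (m n : nat) : C :=
  (k ^ ((m - n) + (n - m)) * green_diag a k (Nat.min m n))%C.

Lemma green_le a k n d : green a k (n + d) n = (k ^ d * green_diag a k n)%C.
Proof. unfold green; now replace (n + d - n + (n - (n + d)))%nat with d by lia; rewrite Nat.min_r by lia. Qed.

Lemma green_ge a k m d : green a k m (m + d) = (k ^ d * green_diag a k m)%C.
Proof. unfold green; now replace (m - (m + d) + (m + d - m))%nat with d by lia; rewrite Nat.min_l by lia. Qed.

Lemma Cmod_one_minus_ak a k : 0 <= a < 1 -> Cmod k <= 1 -> 1 - a <= Cmod (1 - a * k).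
Proof.
  intros Ha Hk.
  assert (H : 1 <= Cmod (1 - a * k) + Cmod (a * k)).
  { rewrite <- Cmod_1 at 1; replace (RtoC 1) with ((1 - a * k) + a * k)%C at 1 by ring.
    apply Cmod_triangle. }
  rewrite Cmod_mult, Cmod_R, Rabs_pos_eq in H by lra.
  generalize (Cmod_ge_0 k); nra.
Qed.

Lemma one_minus_ak_neq_0 a k : 0 <= a < 1 -> Cmod k <= 1 -> (1 - a * k)%C <> 0.
Proof. intros Ha Hk; apply Cmod_gt_0; generalize (Cmod_one_minus_ak a k Ha Hk); lra. Qed.

Lemma Cmod_green_diag a k n : 0 <= a < 1 -> Cmod k <= 1 ->
  Cmod (green_diag a k n) <= / (1 - a) + INR n.
Proof.
  intros Ha Hk; generalize (Cmod_one_minus_ak a k Ha Hk) (Cmod_ge_0 k); intros HD H0.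
  induction n as [|n IH].
  - simpl; rewrite Cmod_div by now apply one_minus_ak_neq_0.
    rewrite Rplus_0_r; unfold Rdiv; rewrite <- (Rmult_1_l (/ (1 - a))).
    apply Rmult_le_compat; auto.
    + apply Rlt_le, Rinv_0_lt_compat; lra.
    + apply Rinv_le_contravar; lra.
  - rewrite S_INR; simpl green_diag.
    eapply Rle_trans; [apply Cmod_triangle|]; rewrite !Cmod_mult.
    generalize (Cmod_ge_0 (green_diag a k n)); intros.
    assert (Cmod k * Cmod k <= 1) by nra; nra.
Qed.

Lemma Cmod_green a k m n : 0 <= a < 1 -> Cmod k <= 1 ->
  Cmod (green a k m n) <= green_bound a m n.
Proof.
  intros Ha Hk; unfold green, green_bound; rewrite Cmod_mult, Cmod_pow.
  rewrite <- (Rmult_1_l (_ + _)); apply Rmult_le_compat.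
  - apply pow_le, Cmod_ge_0.
  - apply Cmod_ge_0.
  - rewrite <- (pow1 (m - n + (n - m))); apply pow_incr; split; [apply Cmod_ge_0|auto].
  - now apply Cmod_green_diag.
Qed.

(** To the right of [m] the sequence is geometric with ratio [k]. To the left, the recursion of
    [green_diag] gives [P (n+1) - P n = k^2 (P n - P (n-1))], which is the homogeneous equation. The
    source sits at the diagonal. *)
Lemma green_column a k m n : 0 <= a < 1 -> Cmod k <= 1 -> k <> 0 ->
  shiftop (JV a (fun _ => 0%C)) (k + / k)%C (green a k m) n
  = if Nat.eqb n m then (- (1))%C else 0%C.
Proof.
  intros Ha Hk Hk0; generalize (one_minus_ak_neq_0 a k Ha Hk); intros HD.
  unfold shiftop, JV; destruct n as [|n].
  - destruct m as [|m].
    + generalize (green_ge a k 0 0) (green_ge a k 0 1); simpl; intros -> ->.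
      field; auto.
    + generalize (green_le a k 0 (S m)) (green_le a k 1 m); simpl; intros -> ->.
      field; auto.
  - destruct (Nat.eqb_spec (S n) m) as [<-|Hne].
    + generalize (green_le a k n 1) (green_le a k (S n) 0) (green_ge a k (S n) 1).
      rewrite !Nat.add_0_r, !Nat.add_1_r; intros -> -> ->; simpl; field; auto.
    + destruct (Nat.le_gt_cases m n) as [H|H].
      * replace n with (m + (n - m))%nat by lia; set (d := (n - m)%nat).
        rewrite <- !Nat.add_succ_r, !green_ge; simpl; field; auto.
      * replace m with (S (S n) + (m - S (S n)))%nat by lia; set (d := (m - S (S n))%nat).
        rewrite green_le.
        replace (S (S n) + d)%nat with (S n + S d)%nat by lia; rewrite green_le.
        replace (S n + S d)%nat with (n + S (S d))%nat by lia; rewrite green_le.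
        simpl; field; auto.
Qed.

(** * Summation by parts and the Green representation *)

(** The operator is symmetric for the bilinear pairing: diagonal terms cancel, the first site
    included, and the off-diagonal ones telescope. *)
Lemma wronskian a v z (h psi : seqC) N :
  sum_n (fun n => h n * shiftop (JV a v) z psi n - psi n * shiftop (JV a v) z h n)%C N
  = (h N * psi (S N) - h (S N) * psi N)%C :> C.
Proof.
  induction N as [|N IH].
  - rewrite sum_O; unfold shiftop, JV; ring.
  - rewrite sum_Sn_C, IH; unfold shiftop, JV; ring.
Qed.

Lemma sum_n_delta (f : nat -> C) m N : (m <= N)%nat ->
  sum_n (fun n => if Nat.eqb n m then f n else RtoC 0) N = f m :> C.
Proof.
  assert (H0 : forall N, (N < m)%nat -> sum_n (fun n => if Nat.eqb n m then f n else RtoC 0) N = RtoC 0 :> C).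
  { induction N0 as [|M IH]; intros HM.
    - rewrite sum_O; destruct (Nat.eqb_spec 0 m); [lia|auto].
    - rewrite sum_Sn_C, IH by lia; destruct (Nat.eqb_spec (S M) m); [lia|ring]. }
  induction N as [|N IH]; intros H.
  - rewrite sum_O; destruct (Nat.eqb_spec 0 m); [now subst|lia].
  - rewrite sum_Sn_C; destruct (Nat.eqb_spec (S N) m) as [<-|].
    + rewrite H0 by lia; ring.
    + rewrite IH by lia; ring.
Qed.

(** The Wronskian identity for the free operator, tested against a Green column, with [V psi] moved
    to the source. Past the diagonal the column has ratio [k], so the boundary term contains only
    [psi (N+1) - k psi N]. *)
Lemma green_representation a k v phi psi m N :
  0 <= a < 1 -> Cmod k <= 1 -> k <> 0 -> (m <= N)%nat ->
  (forall n, (n <= N)%nat -> shiftop (JV a v) (k + / k)%C psi n = phi n) ->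
  (psi m + sum_n (fun n => green a k m n * (phi n - v n * psi n))%C N
   = green a k m N * (psi (S N) - k * psi N))%C.
Proof.
  intros Ha Hk Hk0 Hm Heq.
  generalize (wronskian a (fun _ => 0%C) (k + / k)%C (green a k m) psi N).
  replace (green a k m (S N)) with (k * green a k m N)%C.
  2: { replace N with (m + (N - m))%nat by lia; rewrite <- Nat.add_succ_r, !green_ge.
       simpl; ring. }
  intros HW; transitivity (green a k m N * psi (S N) - k * green a k m N * psi N)%C; [|ring].
  rewrite <- HW, <- (sum_n_delta psi m N Hm).
  transitivity (sum_n (fun n => (if Nat.eqb n m then psi n else RtoC 0)
                  + green a k m n * (phi n - v n * psi n))%C N).
  { symmetry; apply (sum_n_plus (G := C_AbelianMonoid)). }
  apply sum_n_ext_loc; intros n Hn.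
  rewrite green_column, <- (Heq n Hn) by auto.
  match goal with |- @eq _ ?x ?y => change (@eq C x y) end.
  transitivity (green a k m n * shiftop (JV a (fun _ => 0%C)) (k + / k) psi n
                + if Nat.eqb n m then psi n else RtoC 0)%C.
  - unfold shiftop, JV; destruct n; ring.
  - destruct (Nat.eqb n m); ring.
Qed.

Lemma green_estimate a k v phi psi m N :
  0 <= a < 1 -> Cmod k <= 1 -> k <> 0 -> (m <= N)%nat ->
  (forall n, (n <= N)%nat -> shiftop (JV a v) (k + / k)%C psi n = phi n) ->
  Cmod (psi m) <= sum_n (fun n => green_bound a m n * Cmod (phi n)) N
    + sum_n (fun n => green_bound a m n * (Cmod (v n) * Cmod (psi n))) N
    + green_bound a m m * Cmod (psi (S N) - k * psi N).
Proof.
  intros Ha Hk Hk0 Hm Heq.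
  generalize (green_representation a k v phi psi m N Ha Hk Hk0 Hm Heq); intros H.
  set (s := sum_n (fun n => (green a k m n * (phi n - v n * psi n))%C) N) in *.
  replace (psi m) with (green a k m N * (psi (S N) - k * psi N) - s)%C
    by (rewrite <- H; ring).
  eapply Rle_trans; [apply Cmod_minus_le|]; rewrite Rplus_comm; apply Rplus_le_compat.
  - rewrite <- sum_n_Rplus; eapply Rle_trans; [apply Cmod_sum_n|].
    apply sum_n_le; intros n _; rewrite Cmod_mult.
    rewrite <- Rmult_plus_distr_l.
    apply Rmult_le_compat; auto using Cmod_ge_0, Cmod_green.
    rewrite <- Cmod_mult; apply Cmod_minus_le.
  - rewrite Cmod_mult; apply Rmult_le_compat_r; [apply Cmod_ge_0|].
    eapply Rle_trans; [now apply Cmod_green|]; unfold green_bound.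
    rewrite Nat.min_id, Nat.min_l by auto; lra.
Qed.

(** * Absence of eigenvalues *)

Lemma jacobi_injective a w g k v : 0 <= a < 1 -> hardy_pair a w g ->
  Cmod k <= 1 -> k <> 0 -> (forall n, Cmod (v n) <= w n) ->
  op_injective (shiftop (JV a v) (k + / k)%C).
Proof.
  intros Ha Hp Hk Hk0 Hv psi Hpsi Heq.
  assert (Hg : forall n, 0 < g n) by (intros n; generalize (hp_ge_1 _ _ _ Hp n); lra).
  generalize (l2_lim_0 psi Hpsi); intros Hlim.
  set (x := fun n => Cmod (psi n) / g n).
  assert (Hx : is_lim_seq x 0).
  { refine (is_lim_seq_le_le (fun _ => 0) x _ 0 _ (is_lim_seq_const 0) Hlim).
    intros n; unfold x; split.
    - apply Rdiv_le_0_compat; [apply Cmod_ge_0|apply Hg].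
    - apply Rle_div_l; [apply Hg|]; generalize (Cmod_ge_0 (psi n)) (hp_ge_1 _ _ _ Hp n); nra. }
  intros n0; destruct (Ceq_dec (psi n0) 0) as [|Hn0]; auto; exfalso.
  assert (Hx0 : 0 < x n0) by (apply Rdiv_lt_0_compat; [now apply Cmod_gt_0|apply Hg]).
  destruct (exists_max_of_lim_0 x n0 Hx Hx0) as [m Hm].
  set (M := x m) in *.
  assert (HM : 0 < M) by (eapply Rlt_le_trans; [exact Hx0|apply Hm]).
  assert (Hle : forall n, Cmod (psi n) <= M * g n).
  { intros n; apply Rle_div_l; [apply Hg|apply Hm]. }
  assert (HmM : Cmod (psi m) = M * g m) by (unfold M, x; field; apply Rgt_not_eq, Hg).
  (* A site past the first, where [w] is positive and, as [psi] tends to 0 and [g >= 1], the bound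
     [|psi| <= M g] is strict. *)
  assert (Hn1 : exists n1, Cmod (psi (S n1)) < M).
  { apply is_lim_seq_spec in Hlim; destruct (Hlim (mkposreal _ HM)) as [N HN].
    exists N; specialize (HN (S N) ltac:(lia)); simpl in HN.
    apply Rabs_def2 in HN; lra. }
  destruct Hn1 as [n1 Hn1].
  set (kappa := green_bound a m (S n1) * w (S n1) * (M * g (S n1) - Cmod (psi (S n1)))).
  assert (Hkappa : 0 < kappa).
  { unfold kappa; repeat apply Rmult_lt_0_compat.
    - apply green_bound_pos; lra.
    - apply Hp.
    - generalize (hp_ge_1 _ _ _ Hp (S n1)); nra. }
  (* At the maximising site the estimate reads [M g m <= M g m - kappa] plus the boundary term. The
     latter thus stays above [kappa], although it tends to 0 with [psi]. *)
  assert (Hb : forall N, (m <= N)%nat -> (S n1 <= N)%nat ->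
    kappa <= green_bound a m m * (Cmod (psi (S N)) + Cmod (psi N))).
  { intros N HN1 HN2.
    generalize (green_estimate a k v (fun _ => 0%C) psi m N Ha Hk Hk0 HN1 (fun n _ => Heq n)).
    rewrite HmM, (sum_n_zero (fun n => green_bound a m n * Cmod 0))
      by (intros; rewrite Cmod_0; ring).
    assert (H1 : sum_n (fun n => green_bound a m n * (Cmod (v n) * Cmod (psi n))) N
      + sum_n (fun n => green_bound a m n * w n * (M * g n - Cmod (psi n))) N <= M * g m).
    { apply Rle_trans with (M * sum_n (fun n => green_bound a m n * (w n * g n)) N).
      - rewrite <- sum_n_Rplus, <- sum_n_Rmult_l; apply sum_n_le; intros n _.
        replace (M * (green_bound a m n * (w n * g n))) with
          (green_bound a m n * (w n * Cmod (psi n)) + green_bound a m n * w n * (M * g n - Cmod (psi n)))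
          by ring.
        apply Rplus_le_compat_r, Rmult_le_compat_l; [apply Rlt_le, green_bound_pos; lra|].
        apply Rmult_le_compat_r; [apply Cmod_ge_0|apply Hv].
      - apply Rmult_le_compat_l; [lra|]; apply green_bound_sum; auto; lra. }
    assert (H2 : kappa <= sum_n (fun n => green_bound a m n * w n * (M * g n - Cmod (psi n))) N).
    { apply (term_le_sum_n (fun n => green_bound a m n * w n * (M * g n - Cmod (psi n)))); auto.
      intros n; apply Rmult_le_pos; [apply Rmult_le_pos|].
      - apply Rlt_le, green_bound_pos; lra.
      - apply Hp.
      - generalize (Hle n); lra. }
    assert (H3 : Cmod (psi (S N) - k * psi N) <= Cmod (psi (S N)) + Cmod (psi N)).
    { eapply Rle_trans; [apply Cmod_minus_le|]; rewrite Cmod_mult.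
      generalize (Cmod_ge_0 (psi N)); nra. }
    generalize (green_bound_pos a m m (proj2 Ha)); intros Hgb H.
    apply (Rmult_le_compat_l (green_bound a m m)) in H3; [|lra].
    lra. }
  assert (Hl : is_lim_seq (fun N => green_bound a m m * (Cmod (psi (S N)) + Cmod (psi N))) 0).
  { replace (Finite 0) with (Finite (green_bound a m m * (0 + 0))) by (f_equal; ring).
    apply (is_lim_seq_scal_l _ (green_bound a m m) (0 + 0)), is_lim_seq_plus'; auto.
    now apply is_lim_seq_incr_1 in Hlim. }
  assert (kappa <= 0); [|lra].
  apply (is_lim_seq_le_loc (fun _ => kappa) _ kappa 0) with (2 := is_lim_seq_const kappa) (3 := Hl).
  exists (m + S n1)%nat; intros N HN; apply Hb; lia.
Qed.

(** * Outgoing solutions on finite segments *)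

(** The condition at [N] is the one that cancels the boundary term of [green_representation]. *)
Definition outgoing (a : R) (v : seqC) (k : C) (phi : seqC) (N : nat) (psi : seqC) : Prop :=
  (forall n, (n <= N)%nat -> shiftop (JV a v) (k + / k)%C psi n = phi n)
  /\ psi (S N) = (k * psi N)%C.

(** At the site maximising [|psi| / g], with maximum [M], the Green estimate gives [M <= A + c M].
    The resulting bound does not depend on [N]. *)
Lemma outgoing_bound a w g k v c phi psi A N :
  0 <= a < 1 -> hardy_pair a w g -> Cmod k <= 1 -> k <> 0 -> 0 <= c < 1 ->
  (forall n, Cmod (v n) <= c * w n) ->
  (forall m, sum_n (fun n => green_bound a m n * Cmod (phi n)) N <= A * g m) ->
  outgoing a v k phi N psi ->
  forall m, (m <= N)%nat -> Cmod (psi m) <= A / (1 - c) * g m.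
Proof.
  intros Ha Hp Hk Hk0 Hc Hv Hphi [Heq Hout].
  assert (Hg : forall n, 0 < g n) by (intros n; generalize (hp_ge_1 _ _ _ Hp n); lra).
  destruct (exists_max_upto (fun n => Cmod (psi n) / g n) N) as (m0 & Hm0 & Hmax).
  cbv beta in Hmax; set (M := Cmod (psi m0) / g m0) in *.
  assert (HM : 0 <= M) by (apply Rdiv_le_0_compat; [apply Cmod_ge_0|apply Hg]).
  assert (Hle : forall n, (n <= N)%nat -> Cmod (psi n) <= M * g n).
  { intros n Hn; apply Rle_div_l; [apply Hg|now apply Hmax]. }
  assert (HMA : M <= A / (1 - c)).
  { assert (Hm : Cmod (psi m0) = M * g m0) by (unfold M; field; apply Rgt_not_eq, Hg).
    generalize (green_estimate a k v phi psi m0 N Ha Hk Hk0 Hm0 Heq).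
    rewrite Hout; replace (k * psi N - k * psi N)%C with (RtoC 0) by ring.
    rewrite Cmod_0, Rmult_0_r, Rplus_0_r, Hm.
    assert (H : sum_n (fun n => green_bound a m0 n * (Cmod (v n) * Cmod (psi n))) N
                <= (c * M) * g m0).
    { apply Rle_trans with ((c * M) * sum_n (fun n => green_bound a m0 n * (w n * g n)) N).
      - rewrite <- sum_n_Rmult_l; apply sum_n_le; intros n Hn.
        replace (c * M * (green_bound a m0 n * (w n * g n)))
          with (green_bound a m0 n * (c * w n * (M * g n))) by ring.
        apply Rmult_le_compat_l; [apply Rlt_le, green_bound_pos; lra|].
        apply Rmult_le_compat; auto using Cmod_ge_0.
      - apply Rmult_le_compat_l; [nra|]; apply green_bound_sum; auto; lra. }
    intros H1; generalize (Hphi m0); intros H2.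
    assert (H3 : M * (1 - c) * g m0 <= A * g m0) by lra.
    apply Rmult_le_reg_r in H3; [|apply Hg].
    apply Rmult_le_reg_r with (1 - c); [lra|].
    replace (A / (1 - c) * (1 - c)) with A by (field; lra); lra. }
  intros m Hm; eapply Rle_trans; [now apply Hle|].
  apply Rmult_le_compat_r; [apply Rlt_le, Hg|auto].
Qed.

Lemma outgoing_unique a w g k v c psi N :
  0 <= a < 1 -> hardy_pair a w g -> Cmod k <= 1 -> k <> 0 -> 0 <= c < 1 ->
  (forall n, Cmod (v n) <= c * w n) ->
  outgoing a v k (fun _ => 0%C) N psi -> psi O = 0%C.
Proof.
  intros Ha Hp Hk Hk0 Hc Hv Ho; apply Cmod_eq_0, Rle_antisym; [|apply Cmod_ge_0].
  replace 0 with (0 / (1 - c) * g O) by (unfold Rdiv; ring).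
  apply (outgoing_bound a w g k v c (fun _ => 0%C) psi 0 N); auto; [|lia].
  intros m; rewrite sum_n_zero; [apply Req_le; ring|].
  intros; rewrite Cmod_0; ring.
Qed.

(** The pair holds the values at [n] and [n + 1] of the solution started from [t]. Every equation is
    then solved by construction, and the outgoing condition is a single scalar equation for [t]. *)
Fixpoint shoot_pair (a : R) (v : seqC) (z : C) (phi : seqC) (t : C) (n : nat) : C * C :=
  match n with
  | O => (t, phi O - (a + v O - z) * t)%C
  | S m => let p := shoot_pair a v z phi t m in
           (snd p, phi (S m) - fst p - (v (S m) - z) * snd p)%C
  end.

Definition shoot a v z phi t : seqC := fun n => fst (shoot_pair a v z phi t n).

Lemma shoot_solves a v z phi t n : shiftop (JV a v) z (shoot a v z phi t) n = phi n.
Proof. destruct n; unfold shiftop, JV, shoot; simpl; ring. Qed.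

Lemma shoot_affine a v z phi t n :
  shoot a v z phi t n = (shoot a v z phi 0 n + t * shoot a v z (fun _ => 0%C) 1 n)%C.
Proof.
  assert (H : fst (shoot_pair a v z phi t n) = (fst (shoot_pair a v z phi 0 n)
                + t * fst (shoot_pair a v z (fun _ => 0%C) 1 n))%C
           /\ snd (shoot_pair a v z phi t n) = (snd (shoot_pair a v z phi 0 n)
                + t * snd (shoot_pair a v z (fun _ => 0%C) 1 n))%C); [|apply H].
  induction n as [|n [IH1 IH2]]; simpl; [split; ring|].
  rewrite IH1, IH2; split; ring.
Qed.

(** The outgoing condition is affine in [t]. Were its slope zero, the homogeneous solution with
    value 1 at site 0 would be outgoing, against [outgoing_unique]. *)
Lemma outgoing_exists a w g k v c phi N :
  0 <= a < 1 -> hardy_pair a w g -> Cmod k <= 1 -> k <> 0 -> 0 <= c < 1 ->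
  (forall n, Cmod (v n) <= c * w n) ->
  exists t, outgoing a v k phi N (shoot a v (k + / k)%C phi t).
Proof.
  intros Ha Hp Hk Hk0 Hc Hv; set (z := (k + / k)%C).
  set (B := shoot a v z (fun _ => 0%C) 1); set (A := shoot a v z phi 0).
  assert (HB : (B (S N) - k * B N)%C <> 0).
  { intros H; assert (H1 : B O = 0%C).
    - eapply (outgoing_unique a w g k v c B N); eauto; split.
      + intros n _; apply shoot_solves.
      + replace (B (S N)) with ((B (S N) - k * B N) + k * B N)%C by ring; rewrite H; ring.
    - apply C1_nz; exact H1. }
  exists (- (A (S N) - k * A N) / (B (S N) - k * B N))%C; split.
  - intros n _; apply shoot_solves.
  - rewrite (shoot_affine _ _ _ _ _ (S N)), (shoot_affine _ _ _ _ _ N).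
    fold z A B; field; auto.
Qed.

Lemma Cmod_triangle_rev (x y : C) : Rabs (Cmod x - Cmod y) <= Cmod (x - y).
Proof.
  apply Rabs_le_between'; split.
  - generalize (Cmod_minus_le x (x - y)); replace (x - (x - y))%C with y by ring; lra.
  - generalize (Cmod_triangle y (x - y)); replace (y + (x - y))%C with x by ring; lra.
Qed.

(** A solution is determined by its value [t] at site 0, so compactness of bounded [t] suffices: by
    affinity in [t] the solutions converge at every site. *)
Lemma outgoing_limit a w g k v c phi M :
  0 <= a < 1 -> hardy_pair a w g -> Cmod k <= 1 -> k <> 0 -> 0 <= c < 1 ->
  (forall n, Cmod (v n) <= c * w n) ->
  (forall N psi, outgoing a v k phi N psi -> Cmod (psi O) <= M) ->
  exists (psi : seqC) (Psi : nat -> seqC),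
    (forall n, shiftop (JV a v) (k + / k)%C psi n = phi n)
    /\ (forall N, exists N', (N <= N')%nat /\ outgoing a v k phi N' (Psi N))
    /\ (forall j, is_lim_seq (fun N => Cmod (Psi N j)) (Cmod (psi j))).
Proof.
  intros Ha Hp Hk Hk0 Hc Hv Hb.
  assert (Ht : forall N, exists t, outgoing a v k phi N (shoot a v (k + / k)%C phi t))
    by (intros N; eapply outgoing_exists; eauto).
  set (t := fun N => proj1_sig (constructive_indefinite_description _ (Ht N))).
  assert (Hout : forall N, outgoing a v k phi N (shoot a v (k + / k)%C phi (t N)))
    by (intros N; unfold t; now destruct constructive_indefinite_description).
  destruct (bounded_subsequence_C t M) as (sigma & l & Hs & Hl).
  { intros N; exact (Hb N _ (Hout N)). }
  exists (shoot a v (k + / k)%C phi l), (fun N => shoot a v (k + / k)%C phi (t (sigma N))).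
  split; [intros; apply shoot_solves|split].
  - intros N; exists (sigma N); auto.
  - intros j.
    set (B := shoot a v (k + / k)%C (fun _ => 0%C) 1 j).
    apply is_lim_seq_spec; intros eps.
    assert (Hl' : is_lim_seq (fun N => Cmod (t (sigma N) - l) * Cmod B) 0).
    { replace 0 with (0 * Cmod B) by ring.
      apply (is_lim_seq_scal_r _ (Cmod B) 0), Hl. }
    apply is_lim_seq_spec in Hl'; destruct (Hl' eps) as [N HN]; exists N; intros n Hn.
    eapply Rle_lt_trans; [apply Cmod_triangle_rev|].
    rewrite (shoot_affine _ _ _ _ (t (sigma n))), (shoot_affine _ _ _ _ l); fold B.
    match goal with |- Cmod ?x < _ => replace x with ((t (sigma n) - l) * B)%C by ring end.
    rewrite Cmod_mult; specialize (HN n Hn); apply Rabs_def2 in HN; lra.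
Qed.

(** * Square summability and energy estimates *)

(** Fatou's argument: pass to the limit in each fixed partial sum. *)
Lemma l2_of_limit (psi : seqC) (Psi : nat -> seqC) K :
  (forall j, is_lim_seq (fun N => Cmod (Psi N j)) (Cmod (psi j))) ->
  (forall N, sum_n (fun n => Cmod (Psi N n) ^ 2) N <= K) -> l2 psi.
Proof.
  intros Hlim HK; apply (series_bounded _ K); [intros; apply pow2_ge_0|].
  intros n.
  assert (H : is_lim_seq (fun N => sum_n (fun j => Cmod (Psi N j) ^ 2) n)
                         (sum_n (fun j => Cmod (psi j) ^ 2) n)).
  { assert (H2 : forall j, is_lim_seq (fun N => Cmod (Psi N j) ^ 2) (Cmod (psi j) ^ 2)).
    { intros j; simpl; rewrite Rmult_1_r.
      apply is_lim_seq_ext with (fun N => Cmod (Psi N j) * Cmod (Psi N j)); [intros; ring|].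
      now apply is_lim_seq_mult'. }
    induction n as [|n IH].
    - rewrite sum_O; eapply is_lim_seq_ext; [|apply (H2 O)]; intros; now rewrite sum_O.
    - rewrite sum_Sn_R; eapply is_lim_seq_ext;
        [intros; symmetry; apply sum_Sn_R|]; now apply is_lim_seq_plus'. }
  apply (is_lim_seq_le_loc _ (fun _ => K) _ K) with (2 := H) (3 := is_lim_seq_const K).
  exists n; intros N HN; eapply Rle_trans; [|apply (HK N)].
  apply sum_n_incr; auto; intros; apply pow2_ge_0.
Qed.

(** Convexity of the square applied to [r x + (1 - r) (y / (1 - r))]. *)
Lemma convex_square r x y u : 0 <= r < 1 -> 0 <= x -> 0 <= y -> 0 <= u ->
  u <= r * x + y -> u ^ 2 <= r * x ^ 2 + y ^ 2 / (1 - r).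
Proof.
  intros Hr Hx Hy Hu H.
  apply Rle_trans with ((r * x + y) ^ 2); [apply pow_incr; lra|].
  cut (0 <= r * x ^ 2 + y ^ 2 / (1 - r) - (r * x + y) ^ 2); [lra|].
  replace (r * x ^ 2 + y ^ 2 / (1 - r) - (r * x + y) ^ 2)
    with (r / (1 - r) * ((1 - r) * x - y) ^ 2) by (field; lra).
  apply Rmult_le_pos; [apply Rdiv_le_0_compat; lra|apply pow2_ge_0].
Qed.

(** After squaring by convexity and summing, the [r]-part is absorbed on the left; the index shift
    leaves only [x N], which vanishes. *)
Lemma backward_energy (x y : nat -> R) r N :
  0 <= r < 1 -> (forall n, 0 <= x n) -> (forall n, 0 <= y n) -> x N = 0 ->
  (forall n, (n < N)%nat -> x n <= r * x (S n) + y (S n)) ->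
  (1 - r) * sum_n (fun n => x n ^ 2) N <= sum_n (fun n => y n ^ 2) N / (1 - r).
Proof.
  intros Hr Hx Hy HN H.
  assert (Hc : forall M, (M <= N)%nat -> sum_n (fun n => x n ^ 2) M
    <= x M ^ 2 + r * sum_n (fun n => x n ^ 2) M + sum_n (fun n => y n ^ 2) M / (1 - r)).
  { induction M as [|M IH]; intros HM.
    - rewrite !sum_O; generalize (pow2_ge_0 (x O)); intros.
      assert (0 <= y O ^ 2 / (1 - r)) by (apply Rdiv_le_0_compat; [apply pow2_ge_0|lra]).
      nra.
    - rewrite !sum_Sn_R; specialize (IH ltac:(lia)).
      generalize (convex_square r (x (S M)) (y (S M)) (x M) Hr (Hx _) (Hy _) (Hx _) (H M ltac:(lia))).
      unfold Rdiv in *; lra. }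
  specialize (Hc N (Nat.le_refl N)); rewrite HN in Hc; lra.
Qed.

Lemma forward_energy (x y : nat -> R) r N :
  0 <= r < 1 -> (forall n, 0 <= x n) -> (forall n, 0 <= y n) ->
  (forall n, x (S n) <= r * x n + y n) ->
  (1 - r) * sum_n (fun n => x n ^ 2) N <= x O ^ 2 + sum_n (fun n => y n ^ 2) N / (1 - r).
Proof.
  intros Hr Hx Hy H.
  assert (Hc : sum_n (fun n => x n ^ 2) N + (r * x N ^ 2 + y N ^ 2 / (1 - r))
    <= x O ^ 2 + r * sum_n (fun n => x n ^ 2) N + sum_n (fun n => y n ^ 2) N / (1 - r)).
  { induction N as [|N IH].
    - rewrite !sum_O; lra.
    - rewrite !sum_Sn_R.
      generalize (convex_square r (x N) (y N) (x (S N)) Hr (Hx _) (Hy _) (Hx _) (H N)).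
      unfold Rdiv in *; lra. }
  assert (0 <= y N ^ 2 / (1 - r)) by (apply Rdiv_le_0_compat; [apply pow2_ge_0|lra]).
  generalize (pow2_ge_0 (x N)); nra.
Qed.

(* With [chi n = psi (n+1) - k psi n] the equation factors into the first-order recurrences
   [chi n = k (chi (n+1) - f (n+1))], solved backwards from [chi N = 0], and
   [psi (n+1) = k psi n + chi n], solved forwards. *)
Lemma outgoing_energy a k : 0 <= a < 1 -> Cmod k < 1 -> k <> 0 ->
  exists K, 0 <= K /\ forall N f psi, outgoing a (fun _ => 0%C) k f N psi ->
    sum_n (fun n => Cmod (psi n) ^ 2) N <= K * sum_n (fun n => Cmod (f n) ^ 2) N.
Proof.
  intros Ha Hk Hk0; set (r := Cmod k) in *.
  assert (Hr : 0 <= r < 1) by (split; [apply Cmod_ge_0|auto]).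
  set (s := / (1 - r)); assert (Hs : 0 < s) by (apply Rinv_0_lt_compat; lra).
  set (b := / (1 - a)); assert (Hb : 0 < b) by (apply Rinv_0_lt_compat; lra).
  (* The energy of [chi] costs [s^2] and [|psi 0|^2] costs [2 b^2 (s^2 + 1)]; the forward estimate
     turns them into [s] times their combination. *)
  exists (s * (2 * b ^ 2 * (s ^ 2 + 1) + s ^ 3)); split.
  { apply Rmult_le_pos; [lra|]; apply Rplus_le_le_0_compat; [|apply pow_le; lra].
    generalize (pow2_ge_0 b) (pow2_ge_0 s); nra. }
  intros N f psi [Heq Hout].
  set (F := sum_n (fun n => Cmod (f n) ^ 2) N).
  set (P := sum_n (fun n => Cmod (psi n) ^ 2) N).
  set (chi := fun n => (psi (S n) - k * psi n)%C).
  set (X := sum_n (fun n => Cmod (chi n) ^ 2) N).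
  assert (HX : (1 - r) * X <= F / (1 - r)).
  { apply (backward_energy (fun n => Cmod (chi n)) (fun n => Cmod (f n)));
      auto using Cmod_ge_0.
    - unfold chi; rewrite Hout; replace (k * psi N - k * psi N)%C with (RtoC 0) by ring.
      apply Cmod_0.
    - intros n Hn; replace (chi n) with (k * chi (S n) - k * f (S n))%C.
      + eapply Rle_trans; [apply Cmod_minus_le|]; rewrite !Cmod_mult; fold r.
        generalize (Cmod_ge_0 (f (S n))); nra.
      + rewrite <- (Heq (S n) ltac:(lia)); unfold chi, shiftop, JV; field; auto. }
  assert (HP : (1 - r) * P <= Cmod (psi O) ^ 2 + X / (1 - r)).
  { apply (forward_energy (fun n => Cmod (psi n)) (fun n => Cmod (chi n)));
      auto using Cmod_ge_0.
    intros n; replace (psi (S n)) with (k * psi n + chi n)%C by (unfold chi; ring).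
    eapply Rle_trans; [apply Cmod_triangle|]; rewrite Cmod_mult; fold r; lra. }
  (* The equation at the first site is [psi 0 (1 - a k) = k (chi 0 - f 0)]. *)
  assert (H0 : Cmod (psi O) * (1 - a) <= Cmod (chi O) + Cmod (f O)).
  { apply Rle_trans with (Cmod (psi O) * Cmod (1 - a * k)).
    - apply Rmult_le_compat_l; [apply Cmod_ge_0|apply Cmod_one_minus_ak; fold r; lra].
    - rewrite <- Cmod_mult; replace (psi O * (1 - a * k))%C with (k * (chi O - f O))%C.
      + rewrite Cmod_mult; fold r; generalize (Cmod_minus_le (chi O) (f O)) (Cmod_ge_0 (chi O - f O)).
        nra.
      + rewrite <- (Heq O ltac:(lia)); unfold chi, shiftop, JV; field; auto. }
  assert (HcX : Cmod (chi O) ^ 2 <= X)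
    by (apply (term_le_sum_n (fun n => Cmod (chi n) ^ 2)); [intros; apply pow2_ge_0|lia]).
  assert (HfF : Cmod (f O) ^ 2 <= F)
    by (apply (term_le_sum_n (fun n => Cmod (f n) ^ 2)); [intros; apply pow2_ge_0|lia]).
  assert (HX' : X <= s ^ 2 * F).
  { apply (Rmult_le_compat_l s) in HX; [|lra].
    replace (s * ((1 - r) * X)) with (1 * X) in HX by (unfold s; field; lra).
    replace (s * (F / (1 - r))) with (s ^ 2 * F) in HX by (unfold s; field; lra); lra. }
  assert (H0' : Cmod (psi O) ^ 2 <= 2 * b ^ 2 * (s ^ 2 + 1) * F).
  { assert (H1 : Cmod (psi O) <= b * (Cmod (chi O) + Cmod (f O))).
    { apply (Rmult_le_compat_l b) in H0; [|lra].
      replace (b * (Cmod (psi O) * (1 - a))) with (Cmod (psi O)) in H0 by (unfold b; field; lra).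
      auto. }
    apply Rle_trans with ((b * (Cmod (chi O) + Cmod (f O))) ^ 2).
    - apply pow_incr; split; [apply Cmod_ge_0|auto].
    - replace (2 * b ^ 2 * (s ^ 2 + 1) * F) with (b ^ 2 * (2 * (s ^ 2 * F + F))) by ring.
      rewrite Rpow_mult_distr; apply Rmult_le_compat_l; [apply pow2_ge_0|].
      generalize (pow2_ge_0 (Cmod (chi O) - Cmod (f O))); nra. }
  apply (Rmult_le_compat_l s) in HP; [|lra].
  replace (s * ((1 - r) * P)) with (1 * P) in HP by (unfold s; field; lra).
  rewrite Rmult_1_l in HP; eapply Rle_trans; [exact HP|].
  rewrite Rmult_assoc; apply Rmult_le_compat_l; [lra|].
  unfold Rdiv; fold s.
  apply (Rmult_le_compat_r s) in HX'; [|lra]; lra.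
Qed.

(** * The Joukowski parametrisation of the spectral parameter *)

Lemma Csqrt_exists (w : C) : exists s : C, (s * s)%C = w.
Proof.
  destruct w as [x y]; set (r := Cmod (x, y)).
  assert (Hr : r ^ 2 = x ^ 2 + y ^ 2) by apply Cmod2_alt.
  assert (Hxr : Rabs x <= r) by (apply (re_le_Cmod (x, y))).
  apply Rabs_le_between in Hxr.
  set (p := sqrt ((r + x) / 2)); set (q := sqrt ((r - x) / 2)).
  assert (Hp : p * p = (r + x) / 2) by (apply sqrt_sqrt; lra).
  assert (Hq : q * q = (r - x) / 2) by (apply sqrt_sqrt; lra).
  assert (Hpq : p * q = Rabs y / 2).
  { unfold p, q; rewrite <- sqrt_mult by lra.
    replace ((r + x) / 2 * ((r - x) / 2)) with ((Rabs y / 2) ^ 2).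
    - apply sqrt_pow2; generalize (Rabs_pos y); lra.
    - replace ((Rabs y / 2) ^ 2) with (Rabs y ^ 2 / 4) by field; rewrite pow2_abs; nra. }
  destruct (Rle_dec 0 y) as [Hy|Hy].
  - exists (p, q); rewrite Rabs_pos_eq in Hpq by auto.
    unfold Cmult; simpl; f_equal; lra.
  - exists (p, - q); rewrite Rabs_left in Hpq by lra.
    unfold Cmult; simpl; f_equal; lra.
Qed.

(** The roots of [k^2 - z k + 1] have product 1, so one of them lies in the closed unit disc. *)
Lemma joukowski_root (z : C) : exists k : C, k <> 0 /\ Cmod k <= 1 /\ z = (k + / k)%C.
Proof.
  destruct (Csqrt_exists (z * z - 4)%C) as [s Hs].
  set (k1 := ((z + s) / 2)%C); set (k2 := ((z - s) / 2)%C).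
  assert (H2 : RtoC 2 <> 0) by (intros H'; apply RtoC_inj in H'; lra).
  assert (H12 : (k1 * k2 = 1)%C).
  { replace (k1 * k2)%C with ((z * z - s * s) / 4)%C.
    - rewrite Hs; field; intros H'; apply RtoC_inj in H'; lra.
    - unfold k1, k2; field; split; auto; intros H'; apply RtoC_inj in H'; lra. }
  assert (Hsum : (k1 + k2 = z)%C) by (unfold k1, k2; field; auto).
  assert (Hgen : forall p q : C, (p * q = 1)%C -> (p + q = z)%C -> Cmod p <= 1 ->
            exists k : C, k <> 0 /\ Cmod k <= 1 /\ z = (k + / k)%C).
  { intros p q Hpq Hz Hp1; exists p.
    assert (Hp0 : p <> 0) by (intros ->; rewrite Cmult_0_l in Hpq; now apply C1_nz).
    repeat split; auto; rewrite <- Hz; f_equal.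
    replace q with (p * q * / p)%C by (field; auto); rewrite Hpq; ring. }
  destruct (Rle_dec (Cmod k1) 1) as [H1|H1]; [now apply (Hgen k1 k2)|].
  apply (Hgen k2 k1).
  - rewrite <- H12; ring.
  - rewrite <- Hsum; ring.
  - apply (f_equal Cmod) in H12; rewrite Cmod_mult, Cmod_1 in H12.
    generalize (Cmod_ge_0 k2); nra.
Qed.

Lemma Cinv_unit (k : C) : Cmod k = 1 -> (/ k)%C = Cconj k.
Proof.
  intros H; assert (Hk : k <> 0) by (apply Cmod_gt_0; lra).
  generalize (Cmod2_conj k); rewrite H, pow1; intros H1.
  replace (Cconj k) with (k * Cconj k * / k)%C by (field; auto); rewrite <- H1; ring.
Qed.

Lemma joukowski_unit (k : C) : Cmod k = 1 -> on_interval_m2_2 (k + / k)%C.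
Proof.
  intros H; rewrite Cinv_unit by auto; generalize (re_le_Cmod k); rewrite H.
  intros Hk; apply Rabs_le_between in Hk.
  destruct k as [x y]; unfold on_interval_m2_2, Re, Im, Cconj, Cplus in *; simpl in *; lra.
Qed.

Lemma joukowski_interval (z : C) : on_interval_m2_2 z ->
  exists k : C, Cmod k = 1 /\ z = (k + / k)%C.
Proof.
  destruct z as [x y]; unfold on_interval_m2_2, Re, Im; simpl; intros [-> Hx].
  set (k := (x / 2, sqrt (1 - (x / 2) ^ 2)) : C).
  assert (Hk : Cmod k = 1).
  { unfold Cmod, k; simpl fst; simpl snd; rewrite pow2_sqrt by nra.
    transitivity (sqrt 1); [f_equal; ring|apply sqrt_1]. }
  exists k; split; auto; rewrite Cinv_unit by auto.
  unfold k, Cconj, Cplus; simpl; f_equal; lra.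
Qed.

(** * Solvability with the potential and surjectivity off the interval *)

Lemma l2_plus (x y : seqC) : l2 x -> l2 y -> l2 (fun n => x n + y n)%C.
Proof.
  intros Hx Hy.
  apply (ex_series_le (fun n => Cmod (x n + y n)%C ^ 2)
           (fun n => 2 * Cmod (x n) ^ 2 + 2 * Cmod (y n) ^ 2)).
  - intros n; change (norm (Cmod (x n + y n) ^ 2)) with (Rabs (Cmod (x n + y n) ^ 2)).
    rewrite Rabs_pos_eq by apply pow2_ge_0.
    generalize (Cmod_triangle (x n) (y n)) (Cmod_ge_0 (x n + y n)); intros.
    apply Rle_trans with ((Cmod (x n) + Cmod (y n)) ^ 2); [apply pow_incr; lra|].
    generalize (pow2_ge_0 (Cmod (x n) - Cmod (y n))); lra.
  - apply (ex_series_plus (fun n => 2 * Cmod (x n) ^ 2) (fun n => 2 * Cmod (y n) ^ 2)).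
    + apply (ex_series_scal_l 2 (fun n => Cmod (x n) ^ 2)); exact Hx.
    + apply (ex_series_scal_l 2 (fun n => Cmod (y n) ^ 2)); exact Hy.
Qed.

Lemma l2_le (x y : seqC) : (forall n, Cmod (x n) <= Cmod (y n)) -> l2 y -> l2 x.
Proof.
  intros H; apply (ex_series_le (fun n => Cmod (x n) ^ 2) (fun n => Cmod (y n) ^ 2)).
  intros n; change (norm (Cmod (x n) ^ 2)) with (Rabs (Cmod (x n) ^ 2)).
  rewrite Rabs_pos_eq by apply pow2_ge_0; apply pow_incr; split; [apply Cmod_ge_0|auto].
Qed.

Lemma weight_le_1 a w g n : 0 <= a < 1 -> hardy_pair a w g -> 0 <= w n * g n <= 1.
Proof.
  intros Ha Hp.
  assert (H : forall n, 0 <= w n * g n).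
  { intros j; apply Rmult_le_pos; [apply Hp|]; generalize (hp_ge_1 _ _ _ Hp j); lra. }
  split; auto; eapply Rle_trans; [|now apply (sum_weight_le_1 a w g n)].
  now apply (term_le_sum_n (fun n => w n * g n)).
Qed.

Lemma weight_le a w g n : hardy_pair a w g -> w n <= w n * g n.
Proof. intros Hp; generalize (hp_ge_1 _ _ _ Hp n) (hp_nonneg _ _ _ Hp n); nra. Qed.

Lemma weighted_solution a w g k v c phi A :
  0 <= a < 1 -> hardy_pair a w g -> Cmod k <= 1 -> k <> 0 -> 0 <= c < 1 ->
  (forall n, Cmod (v n) <= c * w n) ->
  (forall m N, sum_n (fun n => green_bound a m n * Cmod (phi n)) N <= A * g m) ->
  exists psi : seqC,
    (forall n, shiftop (JV a v) (k + / k)%C psi n = phi n)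
    /\ (forall n, Cmod (psi n) <= A / (1 - c) * g n)
    /\ (Cmod k < 1 -> l2 phi -> l2 psi).
Proof.
  intros Ha Hp Hk Hk0 Hc Hv Hphi.
  assert (Hb : forall N psi, outgoing a v k phi N psi -> forall m, (m <= N)%nat ->
            Cmod (psi m) <= A / (1 - c) * g m).
  { intros N psi; now apply (outgoing_bound a w g k v c phi psi A N). }
  assert (HA : 0 <= A).
  { apply Rmult_le_reg_r with (g O); [generalize (hp_ge_1 _ _ _ Hp O); lra|].
    rewrite Rmult_0_l; eapply Rle_trans; [|apply (Hphi O O)].
    apply sum_n_nonneg; intros n; apply Rmult_le_pos; [|apply Cmod_ge_0].
    apply Rlt_le, green_bound_pos; lra. }
  set (B := A / (1 - c)) in *.
  assert (HB : 0 <= B) by (apply Rdiv_le_0_compat; lra).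
  destruct (outgoing_limit a w g k v c phi (B * g O)) as (psi & Psi & Heq & Hout & Hlim); auto.
  { intros N psi Ho; apply (Hb N psi Ho); lia. }
  exists psi; split; [exact Heq|split].
  - intros n.
    apply (is_lim_seq_le_loc _ (fun _ => B * g n) _ (B * g n)) with (2 := Hlim n)
      (3 := is_lim_seq_const _).
    exists n; intros N HN; destruct (Hout N) as (N' & HN' & Ho).
    apply (Hb N' _ Ho); lia.
  - intros Hk1 Hl2.
    destruct (outgoing_energy a k Ha Hk1 Hk0) as (K & HK & Hen).
    apply (l2_of_limit psi Psi (K * (2 * norm2 phi + 2 * B ^ 2)) Hlim).
    intros N; destruct (Hout N) as (N' & HN' & Ho).
    eapply Rle_trans; [apply (sum_n_incr _ N N'); auto; intros; apply pow2_ge_0|].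
    (* The energy estimate concerns the free operator, so [V Psi] joins the source; it is dominated
       by the summable [B w g]. *)
    eapply Rle_trans; [apply (Hen N' (fun n => phi n - v n * Psi N n)%C)|].
    { destruct Ho as [Ho1 Ho2]; split; auto; intros n Hn; rewrite <- (Ho1 n Hn).
      unfold shiftop, JV; destruct n; ring. }
    apply Rmult_le_compat_l; [exact HK|].
    apply Rle_trans with (2 * sum_n (fun n => Cmod (phi n) ^ 2) N'
                          + 2 * B ^ 2 * sum_n (fun n => w n * g n) N').
    + rewrite <- !sum_n_Rmult_l, <- sum_n_Rplus; apply sum_n_le; intros n Hn.
      generalize (weight_le_1 a w g n Ha Hp); intros Hw.
      assert (Hvp : Cmod (v n * Psi N n) <= B * (w n * g n)).
      { rewrite Cmod_mult; apply Rle_trans with (c * w n * (B * g n)).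
        - apply Rmult_le_compat; auto using Cmod_ge_0.
          now apply (Hb N').
        - replace (c * w n * (B * g n)) with (c * (B * (w n * g n))) by ring.
          assert (0 <= B * (w n * g n)) by (apply Rmult_le_pos; lra); nra. }
      generalize (Cmod_minus_le (phi n) (v n * Psi N n)) (Cmod_ge_0 (phi n - v n * Psi N n))
        (Cmod_ge_0 (phi n)); intros H1 H2 H3.
      set (t := w n * g n) in *.
      apply Rle_trans with ((Cmod (phi n) + B * t) ^ 2); [apply pow_incr; lra|].
      (* Since [0 <= t <= 1], [t^2 <= t], and the sum of [w g] controls the squares. *)
      apply Rle_trans with (2 * Cmod (phi n) ^ 2 + 2 * B ^ 2 * t ^ 2).
      * generalize (pow2_ge_0 (Cmod (phi n) - B * t)); nra.
      * apply Rplus_le_compat_l, Rmult_le_compat_l; [generalize (pow2_ge_0 B); lra|nra].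
    + apply Rplus_le_compat.
      * apply Rmult_le_compat_l; [lra|]; apply sum_n_le_Series; auto; intros; apply pow2_ge_0.
      * generalize (sum_weight_le_1 a w g N' Ha Hp) (pow2_ge_0 B); intros; nra.
Qed.

Lemma free_surjective a w g k : 0 <= a < 1 -> hardy_pair a w g -> Cmod k < 1 -> k <> 0 ->
  op_surjective (shiftop (JV a (fun _ => 0%C)) (k + / k)%C).
Proof.
  intros Ha Hp Hk Hk0 phi Hphi.
  destruct (outgoing_energy a k Ha Hk Hk0) as (K & HK & Hen).
  assert (Hb : forall N psi, outgoing a (fun _ => 0%C) k phi N psi ->
            sum_n (fun n => Cmod (psi n) ^ 2) N <= K * norm2 phi).
  { intros N psi Ho; eapply Rle_trans; [apply (Hen N phi psi Ho)|].
    apply Rmult_le_compat_l; auto; apply sum_n_le_Series; auto; intros; apply pow2_ge_0. }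
  destruct (outgoing_limit a w g k (fun _ => 0%C) 0 phi (sqrt (K * norm2 phi)))
    as (psi & Psi & Heq & Hout & Hlim); auto; try lra.
  { intros; rewrite Cmod_0; lra. }
  { intros N psi Ho; rewrite <- (sqrt_pow2 (Cmod (psi O))) by apply Cmod_ge_0.
    apply sqrt_le_1_alt; eapply Rle_trans; [|apply (Hb N psi Ho)].
    apply (term_le_sum_n (fun n => Cmod (psi n) ^ 2)); [intros; apply pow2_ge_0|lia]. }
  exists psi; split; auto.
  apply (l2_of_limit psi Psi (K * norm2 phi) Hlim).
  intros N; destruct (Hout N) as (N' & HN' & Ho).
  eapply Rle_trans; [|apply (Hb N' _ Ho)].
  apply sum_n_incr; auto; intros; apply pow2_ge_0.
Qed.

(** A general square-summable [phi] need not have a finite sum against [green_bound]. Subtracting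
    the free solution [eta] leaves the source [- v eta], bounded by a multiple of [w g], to which
    [weighted_solution] applies. *)
Lemma jacobi_surjective a w g k v c :
  0 <= a < 1 -> hardy_pair a w g -> Cmod k < 1 -> k <> 0 -> 0 <= c < 1 ->
  (forall n, Cmod (v n) <= c * w n) ->
  op_surjective (shiftop (JV a v) (k + / k)%C).
Proof.
  intros Ha Hp Hk Hk0 Hc Hv phi Hphi.
  assert (Hvw : forall n, Cmod (v n) <= w n * g n).
  { intros n; generalize (Hv n) (weight_le a w g n Hp) (hp_nonneg _ _ _ Hp n); nra. }
  destruct (free_surjective a w g k Ha Hp Hk Hk0 phi Hphi) as (eta & Heta & Heqe).
  destruct (l2_bounded eta Heta) as (M & HM & Hbe).
  destruct (weighted_solution a w g k v c (fun n => - (v n * eta n))%C M)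
    as (theta & Heqt & _ & Hl2); auto; try lra.
  { intros m N; apply Rle_trans with (M * sum_n (fun n => green_bound a m n * (w n * g n)) N).
    - rewrite <- sum_n_Rmult_l; apply sum_n_le; intros n _.
      rewrite Cmod_opp, Cmod_mult.
      replace (M * (green_bound a m n * (w n * g n)))
        with (green_bound a m n * (w n * g n * M)) by ring.
      apply Rmult_le_compat_l; [apply Rlt_le, green_bound_pos; lra|].
      apply Rmult_le_compat; auto using Cmod_ge_0.
    - apply Rmult_le_compat_l; auto; apply green_bound_sum; auto; lra. }
  exists (fun n => eta n + theta n)%C; split.
  - apply l2_plus; auto; apply Hl2; auto.
    apply (l2_le _ eta); auto; intros n; rewrite Cmod_opp, Cmod_mult.
    generalize (Hvw n) (weight_le_1 a w g n Ha Hp) (Cmod_ge_0 (eta n)); nra.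
  - intros n; transitivity (phi n + (- (v n * eta n)) + v n * eta n)%C; [|ring].
    rewrite <- (Heqe n), <- (Heqt n); unfold shiftop, JV; destruct n; ring.
Qed.

(** * Failure of surjectivity on the interval *)

Lemma jacobi_not_surjective a w g k v :
  0 <= a < 1 -> hardy_pair a w g -> Cmod k = 1 -> (forall n, Cmod (v n) <= w n) ->
  ~ op_surjective (shiftop (JV a v) (k + / k)%C).
Proof.
  intros Ha Hp Hk Hv Hsurj.
  assert (Hk0 : k <> 0) by (apply Cmod_gt_0; lra).
  assert (Hk1 : Cmod k <= 1) by lra.
  set (phi := fun n => ((/ k) ^ n * (/ INR (S n))%R)%C).
  assert (Hmod : forall n, Cmod (phi n) = / INR (S n)).
  { intros n; unfold phi; rewrite Cmod_mult, Cmod_pow, Cmod_inv, Hk, Rinv_1, pow1, Cmod_R by auto.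
    rewrite Rabs_pos_eq; [ring|]; apply Rlt_le, Rinv_0_lt_compat, INR_S_pos. }
  destruct (Hsurj phi) as (psi & Hpsi & Heq).
  { apply (series_bounded _ 2); [intros; apply pow2_ge_0|]; intros N.
    rewrite (sum_n_ext _ (fun n => (/ INR (S n)) ^ 2)) by (intros; now rewrite Hmod).
    eapply Rle_trans; [apply sum_n_inv_sq_le|].
    generalize (Rinv_0_lt_compat _ (INR_S_pos N)); lra. }
  destruct (l2_bounded psi Hpsi) as (M & HM & HbM).
  set (P := green_diag a k 0).
  assert (HP : 0 < Cmod P).
  { unfold P; simpl; rewrite Cmod_div by now apply one_minus_ak_neq_0.
    apply Rdiv_lt_0_compat; [lra|]; now apply Cmod_gt_0, one_minus_ak_neq_0. }
  (* In the representation at site 0, [psi 0], the boundary term and the contribution of [V psi] are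
     all bounded, hence so is the contribution of [phi]. *)
  assert (Hb : forall N, Cmod P * harm (S N) <= M + M * g O + green_bound a 0 0 * (2 * M)).
  { intros N.
    generalize (green_representation a k v phi psi 0 N Ha Hk1 Hk0 (Nat.le_0_l N) (fun n _ => Heq n)).
    intros H.
    assert (Hsum : sum_n (fun n => green a k 0 n * (phi n - v n * psi n))%C N
      = (P * harm (S N) - sum_n (fun n => green a k 0 n * (v n * psi n))%C N)%C :> C).
    (* Row 0 of the kernel is [P k^n], whose phase [phi] was chosen to cancel. *)
    { assert (Hterm : forall n, (green a k 0 n * phi n = P * (/ INR (S n))%R)%C).
      { intros n; generalize (green_ge a k 0 n); rewrite Nat.add_0_l; intros ->; fold P.
        unfold phi; rewrite Cpow_inv by auto; field; now apply Cpow_nz. }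
      clear H; induction N as [|N IH].
      - rewrite !sum_O.
        replace (green a k 0 0 * (phi O - v O * psi O))%C
          with (green a k 0 0 * phi O - green a k 0 0 * (v O * psi O))%C by ring.
        rewrite Hterm; simpl harm; rewrite Rplus_0_l; reflexivity.
      - rewrite !sum_Sn_C, IH.
        replace (green a k 0 (S N) * (phi (S N) - v (S N) * psi (S N)))%C
          with (green a k 0 (S N) * phi (S N) - green a k 0 (S N) * (v (S N) * psi (S N)))%C by ring.
        rewrite Hterm; change (harm (S (S N))) with (harm (S N) + / INR (S (S N))).
        rewrite RtoC_plus; ring. }
    rewrite Hsum in H.
    set (s := sum_n (fun n => (green a k 0 n * (v n * psi n))%C) N) in *.
    replace (Cmod P * harm (S N)) with (Cmod (P * harm (S N))).
    2: { rewrite Cmod_mult, Cmod_R, Rabs_pos_eq; auto; apply harm_nonneg. }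
    replace (P * harm (S N))%C
      with (green a k 0 N * (psi (S N) - k * psi N) - psi O + s)%C by (rewrite <- H; ring).
    assert (Hs : Cmod s <= M * g O).
    { unfold s; eapply Rle_trans; [apply Cmod_sum_n|].
      apply Rle_trans with (M * sum_n (fun n => green_bound a 0 n * (w n * g n)) N).
      - rewrite <- sum_n_Rmult_l; apply sum_n_le; intros n _; rewrite !Cmod_mult.
        replace (M * (green_bound a 0 n * (w n * g n)))
          with (green_bound a 0 n * (w n * g n * M)) by ring.
        apply Rmult_le_compat; auto using Cmod_green, Cmod_ge_0.
        + apply Rmult_le_pos; apply Cmod_ge_0.
        + apply Rmult_le_compat; auto using Cmod_ge_0.
          eapply Rle_trans; [apply Hv|]; now apply weight_le with a.
      - apply Rmult_le_compat_l; auto; apply green_bound_sum; auto; lra. }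
    assert (Hg : Cmod (green a k 0 N * (psi (S N) - k * psi N)) <= green_bound a 0 0 * (2 * M)).
    { rewrite Cmod_mult; apply Rmult_le_compat; auto using Cmod_ge_0.
      - exact (Cmod_green a k 0 N Ha Hk1).
      - eapply Rle_trans; [apply Cmod_minus_le|]; rewrite Cmod_mult, Hk.
        generalize (HbM N) (HbM (S N)); lra. }
    eapply Rle_trans; [apply Cmod_triangle|].
    generalize (Cmod_minus_le (green a k 0 N * (psi (S N) - k * psi N)) (psi O)) (HbM O); lra. }
  destruct (harm_unbounded ((M + M * g O + green_bound a 0 0 * (2 * M)) / Cmod P)) as [n Hn].
  apply Rlt_div_l in Hn; [|auto].
  generalize (Hb n) (harm_incr n (S n) ltac:(lia)); intros; nra.
Qed.

(** * Density of the range by logarithmic cutoff *)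

Lemma sum_n_support (f : nat -> R) M N :
  (forall n, 0 <= f n) -> (forall n, (M < n)%nat -> f n = 0) -> sum_n f N <= sum_n f M.
Proof.
  intros Hf H0; destruct (Nat.le_gt_cases N M) as [H|H]; [now apply sum_n_incr|].
  apply Req_le; induction N as [|N IH]; [lia|].
  rewrite sum_Sn_R, H0 by lia.
  destruct (Nat.eq_dec N M) as [->|]; [apply Rplus_0_r|rewrite IH by lia; apply Rplus_0_r].
Qed.

Definition truncate (n0 : nat) (phi : seqC) : seqC :=
  fun n => if Nat.leb n n0 then phi n else 0%C.

Lemma truncate_tail (phi : seqC) eps : l2 phi -> 0 < eps ->
  exists n0, forall N, sum_n (fun n => Cmod (truncate n0 phi n - phi n) ^ 2) N <= eps.
Proof.
  intros Hphi Heps.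
  assert (Hnn : forall n, 0 <= Cmod (phi n) ^ 2) by (intros; apply pow2_ge_0).
  generalize (Series_correct _ Hphi); intros Hlim.
  assert (Hlim' : is_lim_seq (sum_n (fun n => Cmod (phi n) ^ 2)) (norm2 phi)) by exact Hlim.
  apply is_lim_seq_spec in Hlim'; destruct (Hlim' (mkposreal _ Heps)) as [n0 Hn0].
  specialize (Hn0 n0 (Nat.le_refl n0)); simpl pos in Hn0; apply Rabs_def2 in Hn0.
  exists n0; intros N.
  assert (Hsplit : sum_n (fun n => Cmod (truncate n0 phi n - phi n) ^ 2) (n0 + N)
    + sum_n (fun n => Cmod (truncate n0 phi n) ^ 2) (n0 + N)
    = sum_n (fun n => Cmod (phi n) ^ 2) (n0 + N)).
  { rewrite <- sum_n_Rplus; apply sum_n_ext; intros n; unfold truncate.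
    destruct (Nat.leb n n0).
    - replace (phi n - phi n)%C with (RtoC 0) by ring; rewrite Cmod_0; simpl; now rewrite Rmult_0_l, Rplus_0_l.
    - replace (0 - phi n)%C with (- phi n)%C by ring; rewrite Cmod_opp, Cmod_0; simpl.
      now rewrite Rmult_0_l, Rplus_0_r. }
  assert (Hle : sum_n (fun n => Cmod (phi n) ^ 2) n0
                <= sum_n (fun n => Cmod (truncate n0 phi n) ^ 2) (n0 + N)).
  { eapply Rle_trans; [|apply (sum_n_incr _ n0); [intros; apply pow2_ge_0|lia]].
    apply sum_n_le; intros n Hn; unfold truncate.
    rewrite (proj2 (Nat.leb_le n n0) Hn); lra. }
  generalize (sum_n_le_Series _ (n0 + N) Hnn Hphi); fold (norm2 phi); intros HS.
  eapply Rle_trans; [apply (sum_n_incr _ N (n0 + N)); [intros; apply pow2_ge_0|lia]|].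
  lra.
Qed.

(* The logarithmic cutoff: its increments are of order [1 / (n log L)], so that its commutator with
   the shift maps sequences of size [sqrt n] to vectors of squared norm [O(1 / log L)]. *)
Definition log_cutoff (L n : nat) : R := 1 - harm (Nat.min n L) / harm L.

Lemma log_cutoff_bounds L n : 0 < harm L -> 0 <= log_cutoff L n <= 1.
Proof.
  intros HL; unfold log_cutoff.
  assert (0 <= harm (Nat.min n L) / harm L) by (apply Rdiv_le_0_compat; auto using harm_nonneg).
  assert (harm (Nat.min n L) / harm L <= 1).
  { apply Rle_div_l; auto; rewrite Rmult_1_l; apply harm_incr; lia. }
  lra.
Qed.

Lemma log_cutoff_step L n : 0 < harm L ->
  0 <= log_cutoff L n - log_cutoff L (S n) <= / INR (S n) * / harm L.
Proof.
  intros HL; assert (Hi : 0 < / harm L) by now apply Rinv_0_lt_compat.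
  assert (Hn : 0 < / INR (S n)) by apply Rinv_0_lt_compat, INR_S_pos.
  replace (log_cutoff L n - log_cutoff L (S n))
    with ((harm (Nat.min (S n) L) - harm (Nat.min n L)) * / harm L)
    by (unfold log_cutoff, Rdiv; ring).
  assert (H : 0 <= harm (Nat.min (S n) L) - harm (Nat.min n L) <= / INR (S n)).
  { destruct (Nat.le_gt_cases L n).
    - rewrite !Nat.min_r by lia; lra.
    - rewrite !Nat.min_l by lia; change (harm (S n)) with (harm n + / INR (S n)); lra. }
  split; [apply Rmult_le_pos|apply Rmult_le_compat_r]; lra.
Qed.

Lemma log_cutoff_0 L n : 0 < harm L -> (L <= n)%nat -> log_cutoff L n = 0.
Proof. intros HL Hn; unfold log_cutoff; rewrite Nat.min_r by auto; field; lra. Qed.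

Lemma sqr_sum_4 x y u t : (x + y + u + t) ^ 2 <= 4 * (x ^ 2 + y ^ 2 + (u ^ 2 + t ^ 2)).
Proof.
  generalize (pow2_ge_0 (x - y)) (pow2_ge_0 (x - u)) (pow2_ge_0 (x - t))
    (pow2_ge_0 (y - u)) (pow2_ge_0 (y - t)) (pow2_ge_0 (u - t)); nra.
Qed.

Lemma Cmod_sum_4 (x y u t : C) : Cmod (x + y + u + t) <= Cmod x + Cmod y + Cmod u + Cmod t.
Proof.
  generalize (Cmod_triangle (x + y + u) t) (Cmod_triangle (x + y) u) (Cmod_triangle x y); lra.
Qed.

(** One factor of the increment absorbs the growth of [x], being at most [1 / ((n+1) harm L)]; the
    other is kept so that the bound telescopes on summation. *)
Lemma log_cutoff_step_sqr L n x B : 0 < harm L -> 0 <= x -> 0 <= B -> x <= B * INR (S n) ->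
  (log_cutoff L n - log_cutoff L (S n)) ^ 2 * x
  <= B * / harm L * (log_cutoff L n - log_cutoff L (S n)).
Proof.
  intros HL Hx HB Hxn; generalize (log_cutoff_step L n HL); intros [H0 H1].
  set (d := log_cutoff L n - log_cutoff L (S n)) in *.
  assert (Hi : 0 < / harm L) by now apply Rinv_0_lt_compat.
  generalize (INR_S_pos n); intros Hn.
  assert (Hd : d * INR (S n) <= / harm L).
  { apply (Rmult_le_compat_r (INR (S n))) in H1; [|lra].
    replace (/ INR (S n) * / harm L * INR (S n)) with (/ harm L) in H1 by (field; lra); auto. }
  apply Rle_trans with (d ^ 2 * (B * INR (S n))).
  - apply Rmult_le_compat_l; [apply pow2_ge_0|auto].
  - replace (d ^ 2 * (B * INR (S n))) with (B * d * (d * INR (S n))) by ring.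
    replace (B * / harm L * d) with (B * d * / harm L) by ring.
    apply Rmult_le_compat_l; [now apply Rmult_le_pos|auto].
Qed.

Lemma jacobi_dense_range a w g k v c :
  0 <= a < 1 -> hardy_pair a w g -> Cmod k <= 1 -> k <> 0 -> 0 <= c < 1 ->
  (forall n, Cmod (v n) <= c * w n) ->
  op_dense_range (shiftop (JV a v) (k + / k)%C).
Proof.
  intros Ha Hp Hk Hk0 Hc Hv phi Hphi eps Heps.
  (* The tail and the three cutoff errors together each get [eps/16]; the factor 4 of [sqr_sum_4]
     makes the total [eps/2]. *)
  destruct (truncate_tail phi (eps / 16) Hphi ltac:(lra)) as [n0 Htail].
  set (phi' := truncate n0 phi) in *.
  assert (Hphi0 : forall n, (n0 < n)%nat -> phi' n = 0%C).
  { intros n Hn; unfold phi', truncate; now rewrite (proj2 (Nat.leb_gt n n0) Hn). }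
  assert (Hphi' : forall n, Cmod (phi' n) <= Cmod (phi n)).
  { intros n; unfold phi', truncate; destruct (Nat.leb n n0); [lra|rewrite Cmod_0; apply Cmod_ge_0]. }
  (* The kernel is at most its diagonal value, so [A] bounds the Green sums of the finitely
     supported [phi'] uniformly in [m]. *)
  set (A := sum_n (fun n => green_bound a n n * Cmod (phi' n)) n0).
  assert (Hgp : forall m n, 0 <= green_bound a m n) by (intros; apply Rlt_le, green_bound_pos; lra).
  assert (HA : 0 <= A)
    by (apply sum_n_nonneg; intros n; apply Rmult_le_pos; auto using Cmod_ge_0).
  destruct (weighted_solution a w g k v c phi' A Ha Hp Hk Hk0 Hc Hv) as (psi & Heq & Hpsi & _).
  { intros m N; apply Rle_trans with A.
    - apply Rle_trans with (sum_n (fun n => green_bound a n n * Cmod (phi' n)) N).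
      + apply sum_n_le; intros n _; apply Rmult_le_compat_r; [apply Cmod_ge_0|].
        unfold green_bound; apply Rplus_le_compat_l, le_INR; lia.
      + apply sum_n_support.
        * intros n; apply Rmult_le_pos; auto using Cmod_ge_0.
        * intros n Hn; rewrite Hphi0, Cmod_0 by auto; ring.
    - generalize (hp_ge_1 _ _ _ Hp m); nra. }
  set (B := A / (1 - c)) in *.
  assert (HB : 0 <= B) by (apply Rdiv_le_0_compat; lra).
  assert (Hpsi2 : forall n, Cmod (psi n) ^ 2 <= B ^ 2 * INR (S n)).
  { intros n; apply Rle_trans with ((B * g n) ^ 2).
    - apply pow_incr; split; [apply Cmod_ge_0|apply Hpsi].
    - rewrite Rpow_mult_distr; apply Rmult_le_compat_l; [apply pow2_ge_0|apply Hp]. }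
  set (T := harm n0 ^ 2 * norm2 phi + 3 * B ^ 2).
  assert (HS : 0 <= norm2 phi).
  { eapply Rle_trans; [|apply (sum_n_le_Series _ O); auto; intros; apply pow2_ge_0].
    apply sum_n_nonneg; intros; apply pow2_ge_0. }
  assert (HT : 0 <= T).
  { unfold T; generalize (pow2_ge_0 (harm n0)) (pow2_ge_0 B); intros.
    assert (0 <= harm n0 ^ 2 * norm2 phi) by now apply Rmult_le_pos.
    lra. }
  (* The summand 1 ensures [1 / harm L <= 1], which lowers a square of it to the first power; the
     rest gives [T / harm L <= eps/16]. *)
  destruct (harm_unbounded (1 + T * 16 / eps)) as [L HL].
  assert (HTe : 0 <= T * 16 / eps) by (apply Rdiv_le_0_compat; lra).
  assert (HL0 : 0 < harm L) by lra.
  assert (HLi : 0 < / harm L) by now apply Rinv_0_lt_compat.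
  assert (HTL : T * / harm L <= eps / 16).
  { assert (H1 : T * 16 / eps <= harm L) by lra.
    apply Rle_div_l in H1; [|auto].
    apply (Rmult_le_reg_r (harm L)); auto.
    replace (T * / harm L * harm L) with T by (field; lra); lra. }
  set (zeta := log_cutoff L).
  set (Psi := fun n => (zeta n * psi n)%C).
  exists Psi; split.
  { apply (series_bounded _ (sum_n (fun n => Cmod (Psi n) ^ 2) L)); [intros; apply pow2_ge_0|].
    intros N; apply sum_n_support; [intros; apply pow2_ge_0|].
    intros n Hn; unfold Psi, zeta; rewrite log_cutoff_0, Cmult_0_l, Cmod_0 by (auto; lia); ring. }
  set (d := fun n => zeta n - zeta (S n)).
  set (e3 := fun n => match n with O => 0 | S m => d m * Cmod (psi m) end).
  set (e4 := fun n => d n * Cmod (psi (S n))).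
  assert (Hd0 : forall n, 0 <= d n) by (intros n; now apply log_cutoff_step).
  assert (Hzeta : forall n, 0 <= zeta n <= 1) by (intros n; now apply log_cutoff_bounds).
  (* The last two terms are the commutator of the cutoff with the left and right shifts. *)
  assert (Hpt : forall n, Cmod (shiftop (JV a v) (k + / k)%C Psi n - phi n)
    <= Cmod (phi' n - phi n) + (1 - zeta n) * Cmod (phi' n) + e3 n + e4 n).
  { intros n.
    set (x3 := match n with O => RtoC 0 | S m => (d m * psi m)%C end).
    replace (shiftop (JV a v) (k + / k)%C Psi n - phi n)%C
      with ((phi' n - phi n) + - ((1 - zeta n)%R * phi' n) + x3 + - (d n * psi (S n)))%C.
    2: { rewrite <- (Heq n); unfold shiftop, JV, Psi, x3, d; destruct n;
         rewrite ?RtoC_minus; ring. }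
    eapply Rle_trans; [apply Cmod_sum_4|].
    rewrite !Cmod_opp, !Cmod_mult, !Cmod_R.
    rewrite (Rabs_pos_eq (1 - zeta n)) by (generalize (Hzeta n); lra).
    rewrite (Rabs_pos_eq (d n)) by auto; unfold e4.
    apply Rplus_le_compat_r, Rplus_le_compat_l; unfold x3, e3; destruct n.
    - rewrite Cmod_0; lra.
    - rewrite Cmod_mult, Cmod_R, Rabs_pos_eq; auto; lra. }
  assert (H2 : forall N, sum_n (fun n => ((1 - zeta n) * Cmod (phi' n)) ^ 2) N
                         <= harm n0 ^ 2 * norm2 phi * / harm L).
  { intros N; apply Rle_trans with (harm n0 ^ 2 * / harm L * sum_n (fun n => Cmod (phi n) ^ 2) N).
    - rewrite <- sum_n_Rmult_l; apply sum_n_le; intros n _.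
      destruct (Nat.le_gt_cases n n0) as [Hn|Hn].
      + rewrite Rpow_mult_distr; apply Rmult_le_compat; try apply pow2_ge_0.
        * assert (H1 : 0 <= 1 - zeta n <= harm n0 * / harm L).
          { split; [generalize (Hzeta n); lra|]; unfold zeta, log_cutoff, Rdiv.
            replace (1 - (1 - harm (Nat.min n L) * / harm L)) with (harm (Nat.min n L) * / harm L) by ring.
            apply Rmult_le_compat_r; [lra|]; apply harm_incr; lia. }
          apply Rle_trans with ((harm n0 * / harm L) ^ 2); [apply pow_incr; lra|].
          rewrite Rpow_mult_distr; apply Rmult_le_compat_l; [apply pow2_ge_0|].
          assert (/ harm L <= 1) by (rewrite <- Rinv_1; apply Rinv_le_contravar; lra).
          simpl; nra.
        * apply pow_incr; split; [apply Cmod_ge_0|auto].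
      + rewrite Hphi0, Cmod_0 by auto.
        replace (((1 - zeta n) * 0) ^ 2) with 0 by ring.
        apply Rmult_le_pos; [apply Rmult_le_pos; [apply pow2_ge_0|lra]|apply pow2_ge_0].
    - replace (harm n0 ^ 2 * norm2 phi * / harm L) with (harm n0 ^ 2 * / harm L * norm2 phi) by ring.
      apply Rmult_le_compat_l; [apply Rmult_le_pos; [apply pow2_ge_0|lra]|].
      apply sum_n_le_Series; auto; intros; apply pow2_ge_0. }
  assert (H3 : forall N, sum_n (fun n => e3 n ^ 2) N <= B ^ 2 * / harm L).
  { assert (Hbl : 0 <= B ^ 2 * / harm L) by (apply Rmult_le_pos; [apply pow2_ge_0|lra]).
    assert (H : forall N, sum_n (fun n => e3 n ^ 2) N <= B ^ 2 * / harm L * (zeta O - zeta N)).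
    { induction N as [|N IH].
      - rewrite sum_O; simpl; lra.
      - rewrite sum_Sn_R; change (e3 (S N)) with (d N * Cmod (psi N)).
        rewrite Rpow_mult_distr.
        generalize (log_cutoff_step_sqr L N (Cmod (psi N) ^ 2) (B ^ 2) HL0 (pow2_ge_0 _) (pow2_ge_0 _) (Hpsi2 N)).
        change (log_cutoff L N - log_cutoff L (S N)) with (d N).
        replace (zeta O - zeta (S N)) with ((zeta O - zeta N) + d N) by (unfold d; ring); lra. }
    intros N; eapply Rle_trans; [apply H|].
    generalize (Hzeta O) (Hzeta N); intros; nra. }
  (* Here increment [n] meets [psi (n+1)]; the factor 2 comes from [n + 2 <= 2 (n + 1)]. *)
  assert (H4 : forall N, sum_n (fun n => e4 n ^ 2) N <= 2 * B ^ 2 * / harm L).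
  { assert (Hbl : 0 <= 2 * B ^ 2 * / harm L)
      by (apply Rmult_le_pos; [generalize (pow2_ge_0 B); lra|lra]).
    assert (Hstep : forall N, e4 N ^ 2 <= 2 * B ^ 2 * / harm L * (zeta N - zeta (S N))).
    { intros N; unfold e4; rewrite Rpow_mult_distr.
      apply (log_cutoff_step_sqr L N (Cmod (psi (S N)) ^ 2) (2 * B ^ 2) HL0 (pow2_ge_0 _)).
      - generalize (pow2_ge_0 B); lra.
      - eapply Rle_trans; [apply Hpsi2|]; rewrite (S_INR (S N)).
        assert (1 <= INR (S N)) by (rewrite S_INR; generalize (pos_INR N); lra).
        generalize (pow2_ge_0 B); nra. }
    assert (H : forall N, sum_n (fun n => e4 n ^ 2) N <= 2 * B ^ 2 * / harm L * (zeta O - zeta (S N))).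
    { induction N as [|N IH].
      - rewrite sum_O; apply Hstep.
      - rewrite sum_Sn_R; generalize (Hstep (S N)); lra. }
    intros N; eapply Rle_trans; [apply H|].
    generalize (Hzeta O) (Hzeta (S N)); intros; nra. }
  apply Rle_lt_trans with (eps / 2); [|lra].
  apply (series_bounded (fun n => Cmod (shiftop (JV a v) (k + / k)%C Psi n - phi n) ^ 2));
    [intros; apply pow2_ge_0|].
  intros N.
  apply Rle_trans with (4 * (sum_n (fun n => Cmod (phi' n - phi n) ^ 2) N
    + sum_n (fun n => ((1 - zeta n) * Cmod (phi' n)) ^ 2) N
    + (sum_n (fun n => e3 n ^ 2) N + sum_n (fun n => e4 n ^ 2) N))).
  - rewrite <- !sum_n_Rplus, <- sum_n_Rmult_l; apply sum_n_le; intros n _.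
    eapply Rle_trans; [|apply sqr_sum_4].
    apply pow_incr; split; [apply Cmod_ge_0|apply Hpt].
  - generalize (Htail N) (H2 N) (H3 N) (H4 N); unfold T in HTL; lra.
Qed.

(** * The spectrum of the perturbed operator *)

Theorem theorem5p10 (a q : R) :
  0 <= a < 1 -> 0 < q <= q_a a ->
  (forall (c : R) (v : nat -> C), c < 1 ->
     (forall k : nat, Cmod (v k) <= c * hardy_weight a q k) ->
     (forall z : C, in_spectrum (JV a v) z <-> on_interval_m2_2 z) /\
     (forall z : C, in_cont_spectrum (JV a v) z <-> on_interval_m2_2 z)) /\
  (forall v : nat -> C,
     (forall k : nat, Cmod (v k) <= 1 * hardy_weight a q k) ->
     forall z : C, ~ in_disc_spectrum (JV a v) z).
Proof.
  intros Ha Hq; generalize (hardy_weight_pair a q Ha Hq).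
  generalize (hardy_weight a q) (fun n => Rpower (INR (S n)) q); intros w g Hp; split.
  - intros c0 v Hc0 Hv0.
    (* The given constant may be negative; since [w >= 0] it can be raised to 0. *)
    assert (Hc : 0 <= Rmax c0 0 < 1) by (split; [apply Rmax_r|apply Rmax_lub_lt; lra]).
    set (c := Rmax c0 0) in *.
    assert (Hv : forall n, Cmod (v n) <= c * w n).
    { intros n; eapply Rle_trans; [apply Hv0|].
      apply Rmult_le_compat_r; [apply Hp|apply Rmax_l]. }
    assert (Hv1 : forall n, Cmod (v n) <= w n).
    { intros n; generalize (Hv n) (hp_nonneg _ _ _ Hp n); nra. }
    assert (Hin : forall z, on_interval_m2_2 z -> in_cont_spectrum (JV a v) z).
    { intros z Hz; destruct (joukowski_interval z Hz) as (k & Hk & ->).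
      assert (Hk0 : k <> 0) by (apply Cmod_gt_0; lra).
      repeat split.
      - apply (jacobi_injective a w g); auto; lra.
      - apply (jacobi_dense_range a w g k v c); auto; lra.
      - now apply (jacobi_not_surjective a w g). }
    assert (Hout : forall z, ~ on_interval_m2_2 z ->
      op_injective (shiftop (JV a v) z) /\ op_surjective (shiftop (JV a v) z)).
    { intros z Hz; destruct (joukowski_root z) as (k & Hk0 & Hk & ->).
      assert (Hk1 : Cmod k < 1).
      { destruct Hk as [Hk|Hk]; auto; now destruct Hz; apply joukowski_unit. }
      split; [apply (jacobi_injective a w g); auto|].
      now apply (jacobi_surjective a w g k v c). }
    split; intros z; split; auto.
    + intros Hs; apply NNPP; intros Hz; exact (Hs (Hout z Hz)).
    + intros Hz [_ Hs]; destruct (Hin z Hz) as (_ & _ & Hns); auto.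
    + intros (_ & _ & Hns); apply NNPP; intros Hz; apply Hns, (Hout z Hz).
  (* A point of the discrete spectrum carries an eigenvector, which injectivity at [c = 1]
     excludes. *)
  - intros v Hv z (_ & (psi & Hpsi & [n Hn] & Heq) & _).
    destruct (joukowski_root z) as (k & Hk0 & Hk & ->).
    apply Hn; refine (jacobi_injective a w g k v Ha Hp Hk Hk0 _ psi Hpsi Heq n).
    intros m; rewrite <- (Rmult_1_l (w m)); apply Hv.
Qed.
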